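(* Let $I\subset(0,\infty)$ be an interval and let $f:I\to\mathbb{R}$ be differentiable on the interior $I^\circ$ of $I$. Let $m\in(0,1]$, $\alpha\in[0,1]$, $q\ge 1$ and $0<\theta\le 1$, and let $a,b$ be real numbers with $a<b$ and $a,\,b/m\in I^\circ$, such that $f'\in L[a,b]$. Suppose that $|f'|^q$ is harmonically $(\alpha,m)$-convex on $[a,b/m]$. Then $$\left|I_f(g;\theta,a,b)\right|\le \frac{ab(b-a)}{2}\,C_4(\theta;a,b)^{1-1/q}\left[C_5(\theta;\alpha;a,b)\,|f'(a)|^q+m\,C_6(\theta;\alpha;a,b)\,|f'(b/m)|^q\right]^{1/q},$$ where $$C_4(\theta;a,b)=\frac{b^{-2}}{\theta+1}\,{}_2F_1\!\left(2,1;\theta+2;1-\tfrac{a}{b}\right)-\frac{b^{-2}}{\theta+1}\,{}_2F_1\!\left(2,\theta+1;\theta+2;1-\tfrac{a}{b}\right)+\left(\frac{a+b}{2}\right)^{-2}\frac{1}{\theta+1}\,{}_2F_1\!\left(2,\theta+1;\theta+2;\tfrac{b-a}{b+a}\right),$$ $$C_5(\theta;\alpha;a,b)=\frac{b^{-2}}{\theta+\alpha+1}\,{}_2F_1\!\left(2,1;\theta+\alpha+2;1-\tfrac{a}{b}\right)-\frac{\beta(\theta+1,\alpha+1)}{b^{2}}\,{}_2F_1\!\left(2,\theta+1;\theta+\alpha+2;1-\tfrac{a}{b}\right)+\frac{\beta(\theta+1,\alpha+1)}{(a+b)^2\,2^{\alpha-2}}\,{}_2F_1\!\left(2,\theta+1;\theta+\alpha+2;\tfrac{b-a}{b+a}\right),$$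 $$C_6(\theta;\alpha;a,b)=C_4(\theta;a,b)-C_5(\theta;\alpha;a,b).$$
   Context: A function $h:J\to\mathbb{R}$ on an interval $J\subset(0,\infty)$ is called harmonically $(\alpha,m)$-convex (with $\alpha\in[0,1]$, $m\in(0,1]$) if $h\left(\frac{mxy}{mty+(1-t)x}\right)\le t^{\alpha}h(x)+m(1-t^{\alpha})h(y)$ for all $x,y\in J$ and $t\in[0,1]$ (for which the left-hand side is defined, i.e. the argument lies in $J$). For $\varphi\in L[c,d]$ and $\theta>0$ the Riemann–Liouville integrals are $J^{\theta}_{c+}\varphi(x)=\frac{1}{\Gamma(\theta)}\int_c^x (x-t)^{\theta-1}\varphi(t)\,dt$ for $x>c$ and $J^{\theta}_{d-}\varphi(x)=\frac{1}{\Gamma(\theta)}\int_x^d (t-x)^{\theta-1}\varphi(t)\,dt$ for $x<d$, where $\Gamma$ is the Euler Gamma function. With $g(x)=1/x$, define $$I_f(g;\theta,a,b)=\frac{f(a)+f(b)}{2}-\frac{\Gamma(\theta+1)}{2}\left(\frac{ab}{b-a}\right)^{\theta}\left\{J^{\theta}_{1/a-}(f\circ g)(1/b)+J^{\theta}_{1/b+}(f\circ g)(1/a)\right\}.$$ $\beta(x,y)=\int_0^1 t^{x-1}(1-t)^{y-1}dt$ ($x,y>0$) is the Beta function, and the hypergeometric function is ${}_2F_1(a,b;c;z)=\frac{1}{\beta(b,c-b)}\int_0^1 t^{b-1}(1-t)^{c-b-1}(1-zt)^{-a}dt$ for $c>b>0$, $|z|<1$. *)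

(* Defs.v *)
From HB Require Import structures.
From mathcomp Require Import all_boot all_order all_algebra.
From mathcomp Require Import all_classical all_reals all_analysis.
Set Implicit Arguments. Unset Strict Implicit. Unset Printing Implicit Defensive.
Import Order.TTheory GRing.Theory Num.Theory numFieldNormedType.Exports.
Local Open Scope classical_set_scope.
Local Open Scope ring_scope.

Section Defs.
Variable R : realType.
Local Notation mu := (@lebesgue_measure R).

Definition Gamma (s : R) : R :=
  \int[mu]_(t in `]0%R, +oo[) (t `^ (s - 1) * expR (- t)).

Definition RL_left (th : R) (phi : R -> R) (c x : R) : R :=
  (Gamma th)^-1 * \int[mu]_(t in `[c, x]) ((x - t) `^ (th - 1) * phi t).
Definition RL_right (th : R) (phi : R -> R) (d x : R) : R :=
  (Gamma th)^-1 * \int[mu]_(t in `[x, d]) ((t - x) `^ (th - 1) * phi t).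

Definition ginv (x : R) : R := x^-1.

Definition Ifrac (f : R -> R) (th a b : R) : R :=
  (f a + f b) / 2
  - Gamma (th + 1) / 2 * (a * b / (b - a)) `^ th
    * (RL_right th (f \o ginv) a^-1 b^-1 + RL_left th (f \o ginv) b^-1 a^-1).

Definition Beta (x y : R) : R :=
  \int[mu]_(t in `[0%R, 1%R]) (t `^ (x - 1) * (1 - t) `^ (y - 1)).

(* Gauss hypergeometric function via Euler's integral representation *)
Definition Hyp2F1 (a b c z : R) : R :=
  (Beta b (c - b))^-1 *
  \int[mu]_(t in `[0%R, 1%R]) (t `^ (b - 1) * (1 - t) `^ (c - b - 1)
                                * (1 - z * t) `^ (- a)).

Definition harm_convex (alpha m : R) (h : R -> R) (J : set R) : Prop :=
  forall x y t, J x -> J y -> 0 <= t <= 1 ->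
    J (m * x * y / (m * t * y + (1 - t) * x)) ->
    h (m * x * y / (m * t * y + (1 - t) * x))
      <= t `^ alpha * h x + m * (1 - t `^ alpha) * h y.

Definition C4 (th a b : R) : R :=
  b ^- 2 / (th + 1) * Hyp2F1 2 1 (th + 2) (1 - a / b)
  - b ^- 2 / (th + 1) * Hyp2F1 2 (th + 1) (th + 2) (1 - a / b)
  + ((a + b) / 2) ^- 2 / (th + 1) * Hyp2F1 2 (th + 1) (th + 2) ((b - a) / (b + a)).

Definition C5 (th alpha a b : R) : R :=
  b ^- 2 / (th + alpha + 1) * Hyp2F1 2 1 (th + alpha + 2) (1 - a / b)
  - Beta (th + 1) (alpha + 1) / b ^+ 2
      * Hyp2F1 2 (th + 1) (th + alpha + 2) (1 - a / b)
  + Beta (th + 1) (alpha + 1) / ((a + b) ^+ 2 * 2 `^ (alpha - 2))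
      * Hyp2F1 2 (th + 1) (th + alpha + 2) ((b - a) / (b + a)).

Definition C6 (th alpha a b : R) : R := C4 th a b - C5 th alpha a b.

End Defs.

(* Main.v *)
Require Import Defs.
From HB Require Import structures.
From mathcomp Require Import all_boot all_order all_algebra.
From mathcomp Require Import all_classical all_reals all_analysis.
From mathcomp Require Import measurable_realfun ring lra.
Import Order.TTheory GRing.Theory Num.Theory numFieldNormedType.Exports.
Local Open Scope classical_set_scope.
Local Open Scope ring_scope.

(** Write [B s = s b + (1 - s) a], so that [a b / B s] runs from [b] to [a] and
    the convexity hypothesis at [(a, b/m)] bounds [|f'(a b / B s)|^q] by
    [s^alpha |f'(a)|^q + m (1 - s^alpha) |f'(b/m)|^q]; in particular [f'] is
    bounded on [[a, b]].  The substitution [t = B s / (a b)] and an integration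
    by parts turn [Ifrac] into
    [- a b (b - a) / 2 * int_0^1 (s^th - (1 - s)^th) / B(s)^2 f'(a b / B s) ds].
    Since [x |-> x^th] is subadditive for [th <= 1],
    [|s^th - (1 - s)^th| <= s^th - (1 - s)^th + 2 max(1 - 2 s, 0)^th], and the
    right-hand side divided by [B(s)^2] is exactly the weight whose integral
    against [1] is [C4] and against [s^alpha] is [C5] (the three summands give
    the three hypergeometric terms).  The power mean inequality for this weight,
    obtained from Young's inequality with a free parameter that is optimised
    after integration, gives the bound. *)

(** * Affine substitution in Lebesgue integrals *)

Section affine_change_of_variable.
Context {R : realType}.
Local Notation mu := (@lebesgue_measure R).
Variables (k c : R) (k0 : k != 0).

Let aff (x : measurableTypeR R) : measurableTypeR R := k * x + c.

Let maff : measurable_fun [set: measurableTypeR R] aff.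
Proof.
apply: measurable_funD => //; exact: measurable_funM.
Qed.

Let nu : {measure set (measurableTypeR R) -> \bar R} :=
  mscale (NngNum (normr_ge0 k))
    (measure_function_pushforward__canonical__measure_function_Measure mu maff).

(** By uniqueness of Lebesgue measure: the pushforward scaled by [|k|] is a measure, and it gives
    each half-open interval its length. For [k < 0] the preimage is closed on the other side, which
    leaves the length unchanged. *)
Lemma lebesgue_measure_affine (A : set R) : measurable A ->
  mu A = (`|k|%:E * mu [set x | A (k * x + c)%R])%E.
Proof.
move=> mA; rewrite -[RHS]/(nu A).
apply: lebesgue_measure_unique => // _ [[x y]] _ <-.
rewrite -[RHS]/(`|k|%:E * mu (aff @^-1` [set` `]x, y]]))%E.
have [kp|kn] := ltrP 0 k.
  have -> : aff @^-1` [set` `]x, y]] = [set` `](x - c) / k, (y - c) / k]].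
    apply/seteqP; split => z /=; rewrite !in_itv /= /aff;
    by rewrite ltr_pdivrMr// ler_pdivlMr// ltrBlDr lerBrDr (mulrC z).
  rewrite !lebesgue_measure_itv/= !lte_fin ltr_pM2r ?invr_gt0// ltrD2r.
  case: ifP => _; last by rewrite mule0.
  by rewrite -EFinB -EFinB -EFinM gtr0_norm//; congr EFin; field.
have {}kn : k < 0 by rewrite lt_neqAle k0.
have -> : aff @^-1` [set` `]x, y]] = [set` `[(y - c) / k, (x - c) / k[].
  apply/seteqP; split => z /=; rewrite !in_itv /= /aff;
  by rewrite ltr_ndivlMr// ler_ndivrMr// ltrBlDr lerBrDr (mulrC z) andbC.
rewrite !lebesgue_measure_itv/= !lte_fin ltr_nM2r ?invr_lt0// ltrD2r.
case: ifP => _; last by rewrite mule0.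
by rewrite -EFinB -EFinB -EFinM ltr0_norm//; congr EFin; field.
Qed.

Let ge0_integral_affine (f : R -> \bar R) (D : set R) : measurable D ->
  measurable_fun D f -> (forall x, D x -> 0 <= f x)%E ->
  (\int[mu]_(y in D) f y =
   `|k|%:E * \int[mu]_(x in aff @^-1` D) f (aff x))%E.
Proof.
move=> mD mf f0.
transitivity (\int[nu]_(y in D) f y)%E.
  by apply: eq_measure_integral => A mA _; exact: lebesgue_measure_affine.
rewrite ge0_integral_mscale//; congr (_ * _)%E.
by rewrite ge0_integral_pushforward// => y; rewrite inE; exact: f0.
Qed.

Lemma integral_affine (f : R -> \bar R) (D : set R) : measurable D ->
  measurable_fun D f ->
  (\int[mu]_(y in D) f y =
   `|k|%:E * \int[mu]_(x in [set x | D (k * x + c)%R]) f (k * x + c)%R)%E.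
Proof.
move=> mD mf; rewrite integralE (ge0_integral_affine (f^\+)%E)//; last 1 first.
  exact: measurable_funepos.
rewrite (ge0_integral_affine (f^\-)%E)//; last exact: measurable_funeneg.
rewrite [in RHS]integralE.
have r0 : 0 < `|k| by rewrite normr_gt0.
(* A positive real factor distributes over extended subtraction even at infinite values, so the
   positive and negative parts can be recombined. *)
have mulB (x y : \bar R) : (`|k|%:E * (x - y) = `|k|%:E * x - `|k|%:E * y)%E.
  case: x y => [x| |] [y| |] //=; rewrite ?gt0_muley ?gt0_muleNy ?lte_fin//=.
  by rewrite -EFinB -!EFinM -EFinB mulrBr.
apply: etrans (esym (mulB _ _)); congr (_ * _ - _ * _)%E;
  by apply: eq_integral => x _; rewrite ?funeposE ?funenegE.
Qed.

Lemma Rintegral_affine (f : R -> R) (D : set R) : measurable D ->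
  measurable_fun D f ->
  \int[mu]_(y in D) f y =
  `|k| * \int[mu]_(x in [set x | D (k * x + c)]) f (k * x + c).
Proof.
move=> mD mf; rewrite /Rintegral integral_affine//; last exact/measurable_EFinP.
have r0 : 0 < `|k| by rewrite normr_gt0.
(* An infinite integral stays infinite after multiplication by [|k| > 0], and [fine] then sends both
   sides to 0. *)
case: (\int[mu]_(x in _) _)%E => [r| |] //=;
  by rewrite ?gt0_muley ?gt0_muleNy ?lte_fin//= mulr0.
Qed.

End affine_change_of_variable.

(** * Rescaling a segment to the unit interval, in both orientations *)

Section segment_change_of_variable.
Context {R : realType}.
Local Notation mu := (@lebesgue_measure R).

Lemma Rintegral_itv01 (f : R -> R) (c d : R) : c < d ->
  measurable_fun `[c, d] f ->
  \int[mu]_(y in `[c, d]) f y =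
  (d - c) * \int[mu]_(s in `[0, 1]) f ((d - c) * s + c).
Proof.
move=> cd mf; have dc0 : 0 < d - c by rewrite subr_gt0.
rewrite (@Rintegral_affine _ (d - c) c)//; last by rewrite gt_eqF.
rewrite gtr0_norm//; congr (_ * Rintegral _ _ _).
apply/seteqP; split => s /=; rewrite !in_itv /= => /andP[h1 h2]; nra.
Qed.

Lemma Rintegral_itv01_rev (f : R -> R) (c d : R) : c < d ->
  measurable_fun `[c, d] f ->
  \int[mu]_(y in `[c, d]) f y =
  (d - c) * \int[mu]_(s in `[0, 1]) f (d - (d - c) * s).
Proof.
move=> cd mf; have dc0 : 0 < d - c by rewrite subr_gt0.
rewrite (@Rintegral_affine _ (- (d - c)) d)//; last by rewrite oppr_eq0 gt_eqF.
rewrite normrN gtr0_norm//; congr (_ * _).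
under eq_Rintegral do rewrite mulNr addrC.
congr (Rintegral _ _ _).
apply/seteqP; split => s /=; rewrite !in_itv /= => /andP[h1 h2]; nra.
Qed.

End segment_change_of_variable.

(** * The fundamental theorem of calculus for a bounded derivative *)

Section FTC_bounded.
Context {R : realType}.
Local Notation mu := (@lebesgue_measure R).

Lemma continuous_primitive (F : R -> R) (a b : R) : continuous F ->
  exists P : R -> R, forall x, a <= x <= b -> is_derive x 1 P (F x).
Proof.
move=> cF.
(* Starting at [a - 1] puts all of [[a, b]] strictly inside [[a - 1, b + 1]], so the derivative is
   two-sided at [a] and [b] as well. *)
exists (fun x => \int[mu]_(t in `[a - 1, x]) F t) => x /andP[ax xb].
have iF : mu.-integrable `[a - 1, b + 1] (EFin \o F).
  apply: continuous_compact_integrable; first exact: segment_compact.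
  exact: continuous_subspaceT.
have [|||dP P'] := @continuous_FTC1_closed R F (a - 1) x (b + 1) _ iF.
- lra.
- lra.
- exact: cF.
by apply: DeriveDef => //; rewrite -P' derive1E.
Qed.

Lemma is_derive_lipschitz (F g : R -> R) (a b M x y : R) :
  (forall z, a <= z <= b -> is_derive z 1 F (g z)) ->
  (forall z, a <= z <= b -> `|g z| <= M) ->
  a <= x -> x <= y -> y <= b -> `|F y - F x| <= M * (y - x).
Proof.
move=> dF gM ax xy yb.
have [||c /andP[xc cy] ->] := @MVT_segment R F g x y xy.
- move=> z; rewrite in_itv /= => /andP[xz zy]; apply: dF; lra.
- apply: derivable_within_continuous => z; rewrite in_itv /= => /andP[xz zy].
  by apply: ex_derive; apply: dF; lra.
- rewrite normrM (ger0_norm (_ : 0 <= y - x)) ?subr_ge0//.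
  apply: ler_wpM2r; first by rewrite subr_ge0.
  apply: gM; move: xc cy; rewrite !bnd_simp; lra.
Qed.

Lemma is_derive_cvg_quotient (F : R -> R) (x l : R) (h : R^nat) :
  is_derive x 1 F l -> (forall n, h n != 0) -> h @ \oo --> 0 ->
  (h n)^-1 * (F (x + h n) - F x) @[n --> \oo] --> l.
Proof.
move=> dF h0 hc.
have dFx : derivable F x 1 by apply: ex_derive.
have := dFx; rewrite /derivable => /cvg_ex[/= l' hl'].
have ll' : l' = l.
  by rewrite -(@derive_val _ _ _ _ _ _ _ dF) /derive; apply/esym/cvg_lim.
rewrite ll' in hl'.
have /cvgr_dnbhsP := hl' => /(_ h (conj h0 hc)).
by under eq_fun do rewrite /= scaler1 (addrC _ x).
Qed.

(** The derivative [g] may be discontinuous, so it is reached as a limit: the difference quotients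
    of [F] are continuous, bounded by [M] through the mean value theorem, and converge to [g].
    Dominated convergence then compares their integrals, which are computable, with that of [g]. *)
Lemma FTC2_bounded (F g : R -> R) (a b M : R) : a < b ->
  (forall z, a <= z <= b -> is_derive z 1 F (g z)) ->
  (forall z, a <= z <= b -> `|g z| <= M) ->
  measurable_fun `[a, b] g ->
  \int[mu]_(x in `[a, b]) g x = F b - F a.
Proof.
move=> ab dF gM mg.
(* Clamping to [[a, b]] extends [F] by constants to a continuous [M]-Lipschitz function [Fe], so
   that [Fe (x + h n)] makes sense beyond [b]. *)
pose cl (x : R) := Num.max a (Num.min x b).
have clab x : a <= cl x <= b by rewrite /cl le_max lexx /= ge_max (ltW ab) ge_min lexx orbT.
have clE x : a <= x <= b -> cl x = x.
  by move=> /andP[ax xb]; rewrite /cl min_l// max_r.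
have ccl : continuous cl.
  move=> x; apply: (@continuous_max R R (cst a) (id \min cst b)).
    exact: cst_continuous.
  by apply: (@continuous_min R R id (cst b)) => //; exact: cst_continuous.
pose Fe := F \o cl.
have cFe : continuous Fe.
  move=> x; apply: continuous_comp; first exact: ccl.
  apply: differentiable_continuous; apply/derivable1_diffP.
  by apply: ex_derive; apply: dF.
have [P dP] := continuous_primitive Fe a (b + 1) cFe.
have lipFe x y : x <= y -> `|Fe y - Fe x| <= M * (y - x).
  move=> xy.
  have M0 : 0 <= M by apply: le_trans (gM a _); rewrite ?normr_ge0// lexx ltW.
  have /andP[a1 _] := clab x; have /andP[_ b1] := clab y.
  have clxy : cl x <= cl y.
    rewrite /cl !minEle; case: (leP x b) => ? /=; case: (leP y b) => ? /=;
      rewrite !maxEle; repeat (case: ifPn; rewrite -?ltNge => ?); lra.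
  apply: (le_trans (is_derive_lipschitz _ _ _ _ _ _ _ dF gM a1 clxy b1)).
  apply: ler_wpM2l => //.
  rewrite /cl !minEle; case: (leP x b) => ? /=; case: (leP y b) => ? /=;
      rewrite !maxEle; repeat (case: ifPn; rewrite -?ltNge => ?); lra.
pose h (n : nat) : R := n.+1%:R^-1.
have h0 n : 0 < h n by rewrite invr_gt0.
have h1 n : h n <= 1 by rewrite invf_le1// ler1n.
have hneq n : h n != 0 by rewrite gt_eqF.
have hc : h @ \oo --> 0 by exact: cvg_harmonic.
pose Q n x := (h n)^-1 * (Fe (x + h n) - Fe x).
have cQ n : continuous (Q n).
  move=> x; rewrite /Q; apply: cvgM; first exact: cvg_cst.
  apply: cvgB; last exact: cFe.
  apply: (@continuous_comp _ _ _ (fun x => x + h n) Fe); last exact: cFe.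
  by apply: cvgD; [exact: cvg_id|exact: cvg_cst].
(* A primitive of [Q n] is the difference quotient of the primitive [P] of [Fe]; its values at [b]
   and [a] will tend to [Fe b] and [Fe a]. *)
have intQ n : (\int[mu]_(x in `[a, b]) (Q n x)%:E =
    ((h n)^-1 * (P (b + h n) - P b) - (h n)^-1 * (P (a + h n) - P a))%:E)%E.
  have dS x : a <= x <= b -> is_derive x 1 (fun x => (h n)^-1 * (P (x + h n) - P x)) (Q n x).
    move=> xab.
    have d1 : is_derive x 1 P (Fe x) by apply: dP; lra.
    have d2 : is_derive (x + h n) 1 P (Fe (x + h n)).
      by apply: dP; have := h0 n; have := h1 n; lra.
    have d3 : is_derive x 1 (fun x => P (x + h n)) (Fe (x + h n)).
      rewrite -[Fe (x + h n)]mulr1.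
      exact: (is_derive1_comp (g := shift (h n)) d2 (is_derive_shift x 1 (h n))).
    have -> : Q n x = (h n)^-1 *: (Fe (x + h n) - Fe x) by [].
    exact: is_deriveZ.
  rewrite (@continuous_FTC2 R (Q n) (fun x => (h n)^-1 * (P (x + h n) - P x)))//.
  - exact: continuous_subspaceT.
  - have cS x : a <= x <= b -> {for x, continuous (fun x => (h n)^-1 * (P (x + h n) - P x))}.
      move=> xab; apply: differentiable_continuous; apply/derivable1_diffP.
      by apply: ex_derive; exact: dS.
    split.
    + move=> x; rewrite in_itv /= => /andP[ax xb].
      by apply: ex_derive; apply: dS; lra.
    + by apply: cvg_at_right_filter; apply: cS; lra.
    + by apply: cvg_at_left_filter; apply: cS; lra.
  - move=> x; rewrite in_itv /= => /andP[ax xb].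
    by rewrite derive1E; apply: derive_val; apply: dS; lra.
have mQ n (D : set R) : measurable_fun D (EFin \o Q n).
  apply/measurable_EFinP; apply: measurable_funTS.
  by apply: continuous_measurable_fun; exact: cQ.
have QE n : (\int[mu]_(x in `[a, b]) (Q n x)%:E = \int[mu]_(x in `]a, b[) (Q n x)%:E)%E.
  by rewrite integral_itv_bndoo//; exact: mQ.
have gE : (\int[mu]_(x in `[a, b]) (g x)%:E = \int[mu]_(x in `]a, b[) (g x)%:E)%E.
  rewrite integral_itv_bndoo//; apply/measurable_EFinP.
  by apply: measurable_funS mg => //; exact: subset_itv_oo_cc.
rewrite /Rintegral gE.
(* On the open interval [x + h n <= b] holds eventually, so the clamping is invisible in the limit;
   at [b] itself the quotients would be 0. *)
have limQ : (\int[mu]_(x in `]a, b[) (Q n x)%:E @[n --> \oo] --> \int[mu]_(x in `]a, b[) (g x)%:E)%E.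
  have [|||||_ _ //] := @dominated_convergence _ _ _ mu `]a, b[ (measurable_itv _)
    (fun n => EFin \o Q n) (EFin \o g) (cst M%:E).
  - by move=> n; exact: mQ.
  - apply/measurable_EFinP.
    by apply: measurable_funS mg => //; exact: subset_itv_oo_cc.
  - apply: aeW => x; rewrite /= in_itv /= => /andP[ax xb].
    apply/cvg_EFin; first by near=> n.
    have dFx : is_derive x 1 F (g x) by apply: dF; lra.
    have := is_derive_cvg_quotient _ _ _ h dFx hneq hc.
    apply: cvg_trans; apply: near_eq_cvg; near=> n.
    have hn : h n <= b - x.
      by near: n; apply: (cvgr_le 0 hc); rewrite subr_gt0.
    by rewrite /= /Q /Fe /= !clE//; have := h0 n; lra.
  - apply: (@integrableS _ _ _ mu `[a, b]) => //; first exact: subset_itv_oo_cc.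
    apply: continuous_compact_integrable; first exact: segment_compact.
    by apply: continuous_subspaceT => x; exact: cst_continuous.
  - apply: aeW => x n _ /=; rewrite lee_fin /Q normrM gtr0_norm ?invr_gt0//.
    rewrite ler_pdivrMl// mulrC.
    have := lipFe x (x + h n); rewrite lerDl ltW// => /(_ isT).
    by rewrite addrAC subrr add0r.
have limP : (\int[mu]_(x in `]a, b[) (Q n x)%:E @[n --> \oo] --> (F b - F a)%:E)%E.
  under eq_fun do rewrite -QE intQ.
  apply/cvg_EFin; first by near=> n.
  have {1}-> : F b = Fe b by rewrite /Fe /= clE// lexx ltW.
  have -> : F a = Fe a by rewrite /Fe /= clE// lexx ltW.
  apply: cvgB; apply: is_derive_cvg_quotient => //; apply: dP; lra.
by rewrite (cvg_unique _ limQ limP).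
Unshelve. all: by end_near. Qed.
End FTC_bounded.

(** * Integrals as limits over an exhausting sequence of segments *)

Section exhaustion.
Context {R : realType}.
Local Notation mu := (@lebesgue_measure R).
Variables (D : set R) (u v : R^nat).
Hypotheses (mD : measurable D) (uvD : forall n, `[u n, v n] `<=` D).
Hypothesis Duv : forall x, D x -> \forall n \near \oo, u n <= x <= v n.

Let cvg_restrict (g : R -> R) x : D x ->
  (EFin \o (g \_ `[u n, v n])) x @[n --> \oo] --> (g x)%:E.
Proof.
move=> Dx; apply: cvg_near_cst.
have := Duv x Dx; apply: filterS => n xn /=.
by rewrite patchE mem_set.
Qed.

Let integral_restrict (g : R -> R) n :
  (\int[mu]_(x in D) (EFin \o (g \_ `[u n, v n])) x =
   \int[mu]_(x in `[u n, v n]) (g x)%:E)%E.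
Proof.
rewrite -[in RHS](setIidr (uvD n)) integral_mkcondr.
by apply: eq_integral => x _; rewrite restrict_EFin.
Qed.

Let measurable_restrict (g : R -> R) n : measurable_fun D g ->
  measurable_fun D (EFin \o (g \_ `[u n, v n])).
Proof.
move=> mg; apply/measurable_EFinP; apply/(measurable_restrict _ _ _) => //.
by apply: measurable_funS mg => // x [].
Qed.

(** Dominated convergence: the truncations of [g] to [[u n, v n]] are eventually equal to [g] at
    each point and are dominated by [|g|]. *)
Lemma cvg_integral_exhaust (g : R -> R) : mu.-integrable D (EFin \o g) ->
  \int[mu]_(x in `[u n, v n]) g x @[n --> \oo] --> \int[mu]_(x in D) g x.
Proof.
move=> ig; have mg : measurable_fun D g.
  by apply/measurable_EFinP; exact: measurable_int ig.
have [|||||_ _ cv] := @dominated_convergence _ _ _ mu D mD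
    (fun n => EFin \o (g \_ `[u n, v n])) (EFin \o g) (abse \o (EFin \o g)).
- by move=> n; exact: measurable_restrict.
- exact/measurable_EFinP.
- by apply: aeW => x; exact: cvg_restrict.
- exact: integrable_abse.
- apply: aeW => x n _ /=; rewrite lee_fin patchE; case: ifP => // _.
  by rewrite normr0.
apply: fine_cvg; rewrite fineK; last exact: integrable_fin_num.
by apply: cvg_trans cv; under eq_fun do rewrite -integral_restrict.
Qed.

(** Fatou's lemma applied to the truncations of [g], whose lower limit is [g] at each point of
    [D]. *)
Lemma integrable_exhaust (g : R -> R) (C : R) : measurable_fun D g ->
  (forall x, D x -> 0 <= g x) ->
  (forall n, \int[mu]_(x in `[u n, v n]) (g x)%:E <= C%:E)%E ->
  mu.-integrable D (EFin \o g).
Proof.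
move=> mg g0 gC; apply/integrableP; split; first exact/measurable_EFinP.
apply: (@le_lt_trans _ _ C%:E); last exact: ltry.
have -> : (\int[mu]_(x in D) `|(EFin \o g) x| = \int[mu]_(x in D)
    limn_einf (fun n => (EFin \o (g \_ `[u n, v n])) x))%E.
  apply: eq_integral => x; rewrite inE => Dx /=.
  rewrite ger0_norm ?g0//; apply/esym.
  exact: (cvg_limn_einf_sup (cvg_restrict g x Dx)).1.
apply: le_trans (@fatou _ _ _ mu D mD
  (fun n => EFin \o (g \_ `[u n, v n])) _ _) _.
- by move=> n; exact: measurable_restrict.
- by move=> n x Dx /=; rewrite lee_fin patchE; case: ifP => // _; exact: g0.
rewrite limn_einf_lim; apply: lime_le; first exact: is_cvg_einfs.
near=> n; apply: le_trans (gC n); rewrite -integral_restrict.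
by apply: ereal_inf_lbound; exists n => /=.
Unshelve. all: by end_near. Qed.

End exhaustion.

(** * Integrals of powers over the unit interval *)

Section power_integrals.
Context {R : realType}.
Local Notation mu := (@lebesgue_measure R).

Lemma is_derive_continuous (F : R -> R) (x l : R) :
  is_derive x 1 F l -> {for x, continuous F}.
Proof.
move=> dF; apply: differentiable_continuous; apply/derivable1_diffP.
exact: ex_derive.
Qed.

Lemma FTC2_segment (F g : R -> R) (a b : R) : a < b ->
  (forall z, a <= z <= b -> is_derive z 1 F (g z)) ->
  (forall z, a <= z <= b -> {for z, continuous g}) ->
  (\int[mu]_(x in `[a, b]) (g x)%:E = (F b - F a)%:E)%E.
Proof.
move=> ab dF cg; rewrite (@continuous_FTC2 _ _ F)//.
- apply: continuous_in_subspaceT => z; rewrite inE /= in_itv; exact: cg.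
- split.
  + move=> x; rewrite in_itv /= => /andP[ax xb].
    by apply: ex_derive; apply: dF; lra.
  + apply: cvg_at_right_filter; apply: is_derive_continuous.
    by apply: dF; lra.
  + apply: cvg_at_left_filter; apply: is_derive_continuous.
    by apply: dF; lra.
- move=> x; rewrite in_itv /= => /andP[ax xb].
  by rewrite derive1E; apply: derive_val; apply: dF; lra.
Qed.

Lemma integrable_itvoo_cc (g : R -> R) (a b : R) : measurable_fun `[a, b] g ->
  mu.-integrable `]a, b[ (EFin \o g) -> mu.-integrable `[a, b] (EFin \o g).
Proof.
move=> mg /integrableP[mo io]; apply/integrableP; split.
  exact/measurable_EFinP.
by rewrite integral_itv_bndoo//; exact: measurableT_comp mo.
Qed.

(** The shift by 3 makes [eps n < 1/2] from [n = 0] on, so [[eps n, 1 - eps n]] is never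
    degenerate. *)
Definition eps (n : nat) : R := n.+3%:R^-1.

Lemma eps_gt0 n : 0 < eps n. Proof. by rewrite invr_gt0. Qed.

Lemma eps_lt_half n : eps n < 2^-1.
Proof. by rewrite ltf_pV2 ?posrE// ltr_nat. Qed.

Lemma cvg_eps : eps @ \oo --> 0.
Proof.
have := @cvg_harmonic R; rewrite -(cvg_shiftn 2).
by under eq_fun do rewrite addn2.
Qed.

Lemma near_eps (x : R) : 0 < x -> \forall n \near \oo, eps n <= x.
Proof. by move=> x0; apply: (cvgr_le 0 cvg_eps). Qed.

Lemma near_itv01 (x : R) : `]0, 1[%classic x ->
  \forall n \near \oo, eps n <= x <= 1 - eps n.
Proof.
rewrite /= in_itv /= => /andP[x0 x1].
near=> n; apply/andP; split; first by near: n; exact: near_eps.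
by rewrite lerBrDl -lerBrDr; near: n; apply: near_eps; rewrite subr_gt0.
Unshelve. all: by end_near. Qed.

Lemma subset_eps01 n : `[eps n, 1 - eps n] `<=` `]0, 1[.
Proof.
move=> x /=; rewrite !in_itv /= => /andP[x0 x1].
by have := eps_gt0 n; lra.
Qed.

Lemma continuous_powR (p x : R) : 0 < x -> {for x, continuous (@powR R ^~ p)}.
Proof. by move=> x0; apply: is_derive_continuous; exact: is_derive1_powR. Qed.

Let is_derive_powRV (p z : R) : 0 < p -> 0 < z ->
  is_derive z 1 (fun t => p^-1 * t `^ p) (z `^ (p - 1)).
Proof.
move=> p0 z0.
have -> : z `^ (p - 1) = p^-1 *: (p * z `^ (p - 1)).
  by rewrite /GRing.scale /= mulrA mulVf ?mul1r// gt_eqF.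
have d := is_derive1_powR p z0; exact: is_deriveZ.
Qed.

Let integral_powR_eps (p : R) n : 0 < p ->
  (\int[mu]_(x in `[eps n, (1 - eps n)%R]) (x `^ (p - 1))%:E =
  (p^-1 * (1 - eps n) `^ p - p^-1 * eps n `^ p)%:E)%E.
Proof.
move=> p0; have := eps_gt0 n; have := eps_lt_half n => e1 e0.
apply: (FTC2_segment (fun t => p^-1 * t `^ p)); first lra.
- by move=> z z0; apply: is_derive_powRV => //; lra.
- by move=> z z0; apply: continuous_powR; lra.
Qed.

Lemma integrable_powR (p : R) : 0 < p ->
  mu.-integrable `[0, 1] (EFin \o (fun t => t `^ (p - 1))).
Proof.
move=> p0; apply: integrable_itvoo_cc; first exact: measurable_funTS.
apply: (integrable_exhaust `]0, 1[ eps (fun n => 1 - eps n) _ _ _ _ p^-1).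
- exact: measurable_itv.
- exact: subset_eps01.
- exact: near_itv01.
- exact: measurable_funTS.
- by move=> x _; exact: powR_ge0.
move=> n; rewrite integral_powR_eps// lee_fin.
have := eps_gt0 n; have := eps_lt_half n => e1 e0.
rewrite lerBlDr ler_wpDr ?mulr_ge0 ?invr_ge0 ?powR_ge0 ?(ltW p0)//.
rewrite -[leRHS]mulr1 ler_wpM2l ?invr_ge0 ?(ltW p0)//.
apply: (@le_trans _ _ (1 `^ p)); last by rewrite powR1.
by apply: ge0_ler_powR; rewrite ?nnegrE ?(ltW p0)//; lra.
Qed.

Lemma cvg_powR_eps (p : R) : 0 < p -> eps n `^ p @[n --> \oo] --> 0.
Proof.
move=> p0; have /cvg_at_rightP := powR_cvg0 p0.
by apply; split; [exact: eps_gt0|exact: cvg_eps].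
Qed.

Lemma cvg_powR_1eps (p : R) : (1 - eps n) `^ p @[n --> \oo] --> (1 : R).
Proof.
have := @continuous_powR p 1 ltr01 => c1.
have e1 : 1 - eps n @[n --> \oo] --> (1 : R).
  by rewrite -[X in _ --> X]subr0; apply: cvgB; [exact: cvg_cst|exact: cvg_eps].
have p1 : (1 : R) `^ p = 1 by rewrite powR1.
by rewrite -[X in _ --> X]p1; exact: (@continuous_cvg _ _ _ _ _ (fun n => 1 - eps n) (@powR R ^~ p)).
Qed.

(** The integrand may be singular at 0, so the primitive [t^p / p] is used on [[eps n, 1 - eps n]],
    followed by a passage to the limit. *)
Lemma Rintegral_powR (p : R) : 0 < p ->
  \int[mu]_(t in `[0, 1]) (t `^ (p - 1)) = p^-1.
Proof.
move=> p0; have ip := integrable_powR _ p0.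
have io : mu.-integrable `]0, 1[ (EFin \o (fun t => t `^ (p - 1))).
  by apply: integrableS ip => //; exact: subset_itv_oo_cc.
have -> : \int[mu]_(t in `[0, 1]) (t `^ (p - 1)) = \int[mu]_(t in `]0, 1[) (t `^ (p - 1)).
  by rewrite /Rintegral integral_itv_bndoo//; exact: measurable_int io.
have c := cvg_integral_exhaust _ _ _ (measurable_itv _) subset_eps01 near_itv01 _ io.
suff c' : \int[mu]_(x in `[eps n, 1 - eps n]) (x `^ (p - 1)) @[n --> \oo] --> p^-1.
  exact: (cvg_unique _ c c').
have -> : (fun n => \int[mu]_(x in `[eps n, 1 - eps n]) (x `^ (p - 1))) =
    (fun n => p^-1 * (1 - eps n) `^ p - p^-1 * eps n `^ p).
  by apply/funext => n; rewrite /Rintegral integral_powR_eps.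
rewrite -[X in _ --> X]subr0 -[X in _ --> X - _]mulr1 -[X in _ --> _ - X](mulr0 p^-1).
apply: cvgB; apply: cvgM; [exact: cvg_cst|exact: cvg_powR_1eps|exact: cvg_cst|].
exact: cvg_powR_eps.
Qed.

End power_integrals.

(** * Recurrence and positivity of the Gamma function *)

Section Gamma_function.
Context {R : realType}.
Local Notation mu := (@lebesgue_measure R).

Lemma Rintegral_gt0 (D : set R) (g : R -> R) (a b c : R) : measurable D ->
  mu.-integrable D (EFin \o g) -> (forall x, D x -> 0 <= g x) ->
  a < b -> `[a, b] `<=` D -> 0 < c ->
  (forall x, a <= x <= b -> c <= g x) -> 0 < \int[mu]_(x in D) g x.
Proof.
move=> mD ig g0 ab abD c0 cg.
have iab : mu.-integrable `[a, b] (EFin \o g) by apply: integrableS ig.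
apply: (@lt_le_trans _ _ (\int[mu]_(x in `[a, b]) c)).
  rewrite Rintegral_cst//= lebesgue_measure_itv /= lte_fin ab -EFinB /=.
  by rewrite mulr_gt0// subr_gt0.
apply: (@le_trans _ _ (\int[mu]_(x in `[a, b]) g x)).
  apply: le_Rintegral => //.
  apply: continuous_compact_integrable; first exact: segment_compact.
  by apply: continuous_subspaceT => x; exact: cst_continuous.
rewrite /Rintegral; apply: fine_le; [exact: integrable_fin_num..|].
apply: ge0_subset_integral => //; first exact: measurable_int ig.
Qed.

Lemma powR_le1D (t p : R) : 0 <= t -> 0 <= p <= 1 -> t `^ p <= 1 + t.
Proof.
move=> t0 /andP[p0 p1]; have [t1|t1] := leP t 1.
  apply: (@le_trans _ _ (1 `^ p)); last by rewrite powR1 lerDl.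
  by apply: ge0_ler_powR; rewrite ?nnegrE.
by apply: (le_trans (ler1_powR (ltW t1) p1)); rewrite lerDr.
Qed.

Let pexp (p t : R) := t `^ p * expR (- t).

Let is_derive_expRN (c t : R) :
  is_derive t 1 (fun t => expR (- (c * t))) (- c * expR (- (c * t))).
Proof.
rewrite mulrC; apply: (@is_derive1_comp _ expR (fun t => - (c * t))).
apply: is_deriveN; rewrite -[X in is_derive _ _ _ X]mulr1.
exact: is_deriveZ.
Qed.

Let is_derive_pexp (p t : R) : 0 < t ->
  is_derive t 1 (pexp p) (p * pexp (p - 1) t - pexp p t).
Proof.
move=> t0; have d1 := is_derive1_powR p t0.
have := is_derive_expRN 1 t; under eq_fun do rewrite mul1r.
rewrite mulN1r mul1r => d2.
apply: is_derive_eq (is_deriveM d1 d2) _.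
by rewrite /pexp /GRing.scale /=; ring.
Qed.

Let continuous_pexp (p t : R) : 0 < t -> {for t, continuous (pexp p)}.
Proof. by move=> t0; apply: is_derive_continuous (is_derive_pexp p t t0). Qed.

Let near_itv0y (x : R) : `]0, +oo[%classic x ->
  \forall n \near \oo, eps n <= x <= n.+1%:R.
Proof.
rewrite /= in_itv /= andbT => x0.
near=> n; apply/andP; split; first by near: n; exact: near_eps.
near: n; have := nbhs_infty_ger x; apply: filterS => n /le_trans; apply.
by rewrite ler_nat.
Unshelve. all: by end_near. Qed.

Let subset_itv0y n : `[eps n, n.+1%:R : R] `<=` `]0, +oo[.
Proof.
by move=> x /=; rewrite !in_itv /= andbT => /andP[+ _]; exact/lt_le_trans/eps_gt0.
Qed.

Let eps_lt_nat n : eps n < n.+1%:R :> R.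
Proof.
have := @eps_lt_half R n; have : 1 <= n.+1%:R :> R by rewrite ler1n.
lra.
Qed.

Let measurable_pexp (D : set R) p : measurable_fun D (pexp p).
Proof.
apply: measurable_funTS; apply: measurable_funM => //.
by apply: measurableT_comp => //; exact: measurable_expR.
Qed.

Let pexp_ge0 (p t : R) : 0 <= pexp p t.
Proof. by rewrite mulr_ge0 ?powR_ge0 ?expR_ge0. Qed.

(** From [t^p <= 1 + t <= 2 e^(t/2)]. *)
Let pexp_le (p t : R) : 0 <= p <= 1 -> 0 <= t -> pexp p t <= 2 * expR (- (2^-1 * t)).
Proof.
move=> p01 t0; apply: (@le_trans _ _ (2 * expR (2^-1 * t) * expR (- t))).
  apply: ler_wpM2r; first exact: expR_ge0.
  apply: (le_trans (powR_le1D t p t0 p01)).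
  by have := expR_ge1Dx (2^-1 * t); lra.
by rewrite -mulrA -expRD ler_wpM2l// ler_expR; lra.
Qed.

Variable p : R.
Hypothesis p01 : 0 < p <= 1.

(** The bound 4 is the integral of the majorant [2 e^(-t/2)] over the half-line. *)
Let integrable_pexp : mu.-integrable `]0, +oo[ (EFin \o pexp p).
Proof.
apply: (@integrable_exhaust _ _ eps (fun n => n.+1%:R) _ _ _ _ 4) => //.
- move=> n.
  apply: (@le_trans _ _ (\int[mu]_(x in `[eps n, n.+1%:R]) (2 * expR (- (2^-1 * x)))%:E)%E).
    apply: ge0_le_integral => //=.
    + by move=> x _; rewrite lee_fin.
    + by apply/measurable_EFinP; exact: measurable_pexp.
    + apply/measurable_EFinP/measurable_funTS; apply: measurable_funM => //.
      apply: measurableT_comp; first exact: measurable_expR.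
      by apply: measurableT_comp => //; exact: measurable_funM.
    + move=> x; rewrite in_itv /= => /andP[ex _]; rewrite lee_fin pexp_le//.
        by case/andP: p01 => /ltW -> ->.
      by rewrite (le_trans (ltW (eps_gt0 n))).
  have -> : (\int[mu]_(x in `[eps n, n.+1%:R]) (2 * expR (- (2^-1 * x)))%:E =
      ((- 4 * expR (- (2^-1 * n.+1%:R))) - (- 4 * expR (- (2^-1 * eps n))))%:E)%E.
    apply: (@FTC2_segment R (fun t => - 4 * expR (- (2^-1 * t)))) => //.
    + move=> z _; have d := is_derive_expRN 2^-1 z.
      by apply: is_derive_eq (is_deriveZ (-4) d) _; rewrite /GRing.scale /=; field.
    + move=> z _; apply: cvgM; first exact: cvg_cst.
      exact: is_derive_continuous (is_derive_expRN 2^-1 z).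
  rewrite lee_fin.
  have : expR (- (2^-1 * eps n)) <= 1 :> R.
    by rewrite -expR0 ler_expR oppr_le0 mulr_ge0// ltW// eps_gt0.
  by have := expR_ge0 (- (2^-1 * n.+1%:R) : R); lra.
Qed.

Let p_gt0 : 0 < p. Proof. by case/andP: p01. Qed.

Let integral_pexp_eps n :
  (\int[mu]_(x in `[eps n, n.+1%:R]) (p * pexp (p - 1) x - pexp p x)%:E =
   (pexp p n.+1%:R - pexp p (eps n))%:E)%E.
Proof.
apply: FTC2_segment => // z /andP[ez _].
- by apply: is_derive_pexp; rewrite (lt_le_trans (eps_gt0 n)).
- have z0 : 0 < z by rewrite (lt_le_trans (eps_gt0 n)).
  by apply: cvgB; [apply: cvgM; [exact: cvg_cst|]|]; exact: continuous_pexp.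
Qed.

(** The integrand is the derivative of [pexp p] plus [pexp p]. The derivative contributes at most
    the boundary value [pexp p n.+1 <= 2], the rest at most the integral of [pexp p]. *)
Let integrable_ppexp : mu.-integrable `]0, +oo[ (EFin \o (fun t => p * pexp (p - 1) t)).
Proof.
apply: (@integrable_exhaust _ _ eps (fun n => n.+1%:R) _ _ _ _
  (2 + \int[mu]_(t in `]0, +oo[) pexp p t)) => //.
- exact: measurable_funM.
- by move=> x _; rewrite mulr_ge0// ltW.
move=> n.
have i2 : mu.-integrable `[eps n, n.+1%:R] (EFin \o pexp p).
  by apply: integrableS integrable_pexp.
have i1 : mu.-integrable `[eps n, n.+1%:R] (EFin \o (fun x => p * pexp (p - 1) x - pexp p x)).
  apply: continuous_compact_integrable; first exact: segment_compact.
  apply: continuous_in_subspaceT => z; rewrite inE /= in_itv /= => /andP[ez _].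
  have z0 : 0 < z by rewrite (lt_le_trans (eps_gt0 n)).
  by apply: cvgB; [apply: cvgM; [exact: cvg_cst|]|]; exact: continuous_pexp.
rewrite (_ : (\int[mu]_(x in _) _ = \int[mu]_(x in `[eps n, n.+1%:R])
    ((p * pexp (p - 1) x - pexp p x)%:E + (pexp p x)%:E))%E); last first.
  by apply: eq_integral => x _; rewrite -EFinD subrK.
rewrite integralD_EFin// integral_pexp_eps [leRHS]EFinD; apply: leeD.
  rewrite lee_fin; have := pexp_ge0 p (eps n).
  have := @pexp_le p n.+1%:R; rewrite ler0n (ltW p_gt0); case/andP: p01 => _ -> /(_ isT isT).
  have : expR (- (2^-1 * n.+1%:R)) <= 1 :> R.
    by rewrite -expR0 ler_expR oppr_le0 mulr_ge0.
  lra.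
rewrite fineK; last exact: integrable_fin_num.
apply: ge0_subset_integral => //; first exact: measurable_int integrable_pexp.
by move=> x _; rewrite lee_fin.
Qed.

Let cvg_pexp_eps : pexp p (eps n) @[n --> \oo] --> 0.
Proof.
apply: (@squeeze_cvgr _ _ _ _ (cst 0) (fun n => eps n `^ p)).
- near=> n; rewrite pexp_ge0 /= /pexp ler_piMr ?powR_ge0//.
  by rewrite -expR0 ler_expR oppr_le0 ltW// eps_gt0.
- exact: cvg_cst.
- exact: cvg_powR_eps.
Unshelve. all: by end_near. Qed.

Let cvg_pexp_nat : pexp p n.+1%:R @[n --> \oo] --> 0.
Proof.
(* With [y = (n + 1) / 2], [2 e^(-y) <= 2 / y = 4 / (n + 1)]. *)
apply: (@squeeze_cvgr _ _ _ _ (cst 0) (fun n => 4 * harmonic n)).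
- near=> n; rewrite pexp_ge0 /=.
  have := @pexp_le p n.+1%:R; rewrite ler0n (ltW p_gt0); case/andP: p01 => _ -> /(_ isT isT).
  move=> /le_trans; apply.
  have n0 : 0 < n.+1%:R :> R by [].
  rewrite expRN (_ : 4 * n.+1%:R^-1 = 2 * (2^-1 * n.+1%:R)^-1 :> R); last by field.
  rewrite ler_wpM2l// lef_pV2 ?posrE ?expR_gt0 ?mulr_gt0//.
  by have := expR_ge1Dx (2^-1 * n.+1%:R : R); lra.
- exact: cvg_cst.
- by rewrite -[X in _ --> X](mulr0 4); apply: cvgM; [exact: cvg_cst|exact: cvg_harmonic].
Unshelve. all: by end_near. Qed.

(** The derivative [p t^(p-1) e^(-t) - t^p e^(-t)] of [t^p e^(-t)] has integral 0, because that
    function vanishes at both ends of the half-line. *)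
Lemma GammaD1 : Gamma (p + 1) = p * Gamma p.
Proof.
rewrite /Gamma addrK.
have mI : measurable (`]0%R, +oo[%classic : set (measurableTypeR R)) by exact: measurable_itv.
have i1 : mu.-integrable `]0, +oo[ (EFin \o pexp (p - 1)).
  have := integrableZl mI p^-1 integrable_ppexp.
  apply: eq_integrable => // x _ /=.
  by rewrite -EFinM mulKf// gt_eqF.
rewrite -RintegralZl//.
have iB : mu.-integrable `]0, +oo[ (EFin \o (fun t => p * pexp (p - 1) t - pexp p t)).
  by have := integrableB mI integrable_ppexp integrable_pexp.
have c := cvg_integral_exhaust _ _ _ mI subset_itv0y near_itv0y _ iB.
suff c0 : \int[mu]_(x in `[eps n, n.+1%:R]) (p * pexp (p - 1) x - pexp p x)
    @[n --> \oo] --> 0.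
  have : \int[mu]_(x in `]0, +oo[) (p * pexp (p - 1) x - pexp p x) = 0.
    exact: (cvg_unique _ c c0).
  by rewrite RintegralB// => /eqP; rewrite subr_eq0 => /eqP ->.
have -> : (fun n => \int[mu]_(x in `[eps n, n.+1%:R]) (p * pexp (p - 1) x - pexp p x)) =
    (fun n => pexp p n.+1%:R - pexp p (eps n)).
  by apply/funext => n; rewrite /Rintegral integral_pexp_eps.
by rewrite -[X in _ --> X]subr0; apply: cvgB.
Qed.

(** The recurrence moves the question to [Gamma (p + 1)], whose integrand is at least [e^(-2)] on
    [[1, 2]]. *)
Lemma Gamma_gt0 : 0 < Gamma p.
Proof.
rewrite -(pmulr_rgt0 _ p_gt0) -GammaD1 /Gamma addrK.
apply: (Rintegral_gt0 _ _ 1 2 (expR (- 2))) => //.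
- by move=> x _; exact: pexp_ge0.
- by lra.
- by move=> x /=; rewrite !in_itv /= andbT; lra.
move=> x x12; rewrite -[leLHS]mul1r; apply: ler_pM; [by []|exact: expR_ge0| |].
- apply: (@le_trans _ _ (1 `^ p)); first by rewrite powR1.
  by apply: ge0_ler_powR; rewrite ?nnegrE ?(ltW p_gt0)//; lra.
- by rewrite ler_expR; lra.
Qed.

End Gamma_function.

(** * [C4] and [C5] as integrals of a single weight *)

Section hypergeometric_constants.
Context {R : realType}.
Local Notation mu := (@lebesgue_measure R).

Lemma integrable_bounded01 (g : R -> R) (M : R) : measurable_fun `[0 : R, 1] g ->
  (forall s : R, 0 <= s <= 1 -> `|g s| <= M) -> mu.-integrable `[0, 1] (EFin \o g).
Proof.
move=> mg gM; apply: measurable_bounded_integrable => //.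
- by rewrite /= lebesgue_measure_itv /= lte_fin ltr01 -EFinB ltry.
- exists M; split; first exact: num_real.
  move=> y My s; rewrite /= in_itv /= => /gM /le_trans; apply; exact: ltW.
Qed.

Lemma Rintegral01_reflect (g : R -> R) : measurable_fun `[0 : R, 1] g ->
  \int[mu]_(s in `[0, 1]) g s = \int[mu]_(s in `[0, 1]) g (1 - s).
Proof.
move=> mg; rewrite (Rintegral_itv01_rev _ 0 1 ltr01)// subr0 mul1r.
by apply: eq_Rintegral => s _; rewrite mul1r.
Qed.

Lemma powR_le1 (s p : R) : 0 <= p -> 0 <= s <= 1 -> s `^ p <= 1.
Proof.
move=> p0 /andP[s0 s1]; rewrite -[leRHS](congr1 (fun h => h p) (@powR1 R)).
by apply: ge0_ler_powR; rewrite ?nnegrE.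
Qed.

Lemma measurable_powR_comp (D : set R) (g : R -> R) (p : R) :
  measurable_fun D g -> measurable_fun D (fun s => g s `^ p).
Proof. by move=> mg; exact: (measurableT_comp (measurable_powR p)). Qed.

Lemma measurable_onem (D : set R) : measurable_fun D (fun s : R => 1 - s).
Proof. by apply: measurable_funTS; exact: measurable_funB. Qed.

Lemma Beta_gt0 (th al : R) : 0 <= th -> 0 <= al -> 0 < Beta (th + 1) (al + 1).
Proof.
move=> th0 al0; rewrite /Beta !addrK.
apply: (Rintegral_gt0 _ _ 4^-1 2^-1 (4^-1 `^ th * 2^-1 `^ al)) => //.
- apply: (integrable_bounded01 _ 1).
    apply: measurable_funM; apply: measurable_powR_comp => //.
    exact: measurable_onem.
  move=> s s01; rewrite ger0_norm ?mulr_ge0 ?powR_ge0// mulr_ile1 ?powR_ge0//;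
    apply: powR_le1 => //; lra.
- by move=> x _; rewrite mulr_ge0 ?powR_ge0.
- by lra.
- by move=> x /=; rewrite !in_itv /=; lra.
- move=> x x12; apply: ler_pM; rewrite ?powR_ge0//;
    apply: ge0_ler_powR; rewrite ?nnegrE//; lra.
Qed.

Lemma Beta1 (p : R) : 0 < p -> Beta 1 p = p^-1.
Proof.
move=> p0; rewrite -(Rintegral_powR _ p0) [RHS]Rintegral01_reflect.
  by rewrite /Beta; apply: eq_Rintegral => s _; rewrite subrr powRr0 mul1r.
exact: measurable_funTS.
Qed.

(** The Beta factor cancels the normalisation of Euler's integral. The separate variable [y] lets
    the exponent [c - b] appear in simplified form. *)
Lemma Hyp2F1_Beta (x b c z y : R) : Beta b y != 0 -> c - b = y ->
  Beta b y * Hyp2F1 x b c z = \int[mu]_(t in `[0%R, 1%R])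
    (t `^ (b - 1) * (1 - t) `^ (y - 1) * (1 - z * t) `^ (- x)).
Proof. by move=> + cb; rewrite -cb => B0; rewrite /Hyp2F1 mulVKf. Qed.

Variables (a b th : R).
Hypotheses (a0 : 0 < a) (ab : a < b) (th0 : 0 < th).

Let b0 : 0 < b. Proof. exact: lt_trans ab. Qed.

(** This is [B s] of the overview. *)
Definition seg (a b s : R) := s * b + (1 - s) * a.

Lemma seg_ge (s : R) : 0 <= s <= 1 -> a <= seg a b s.
Proof. by move: a0 ab; rewrite /seg; nra. Qed.

Lemma seg_gt0 (s : R) : 0 <= s <= 1 -> 0 < seg a b s.
Proof. by move=> s01; exact: lt_le_trans (seg_ge _ s01). Qed.

Lemma seg_le (s : R) : 0 <= s <= 1 -> seg a b s <= b.
Proof. by move: a0 ab; rewrite /seg; nra. Qed.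

(** The maximum extends the correction [2 (1 - 2 s)^th], wanted on [[0, 1/2]] only, by zero to the
    whole unit interval. *)
Definition wbar (s : R) :=
  (s `^ th - (1 - s) `^ th + 2 * Num.max (1 - 2 * s) 0 `^ th) / seg a b s ^+ 2.

Lemma measurable_segV2 (D : set R) : measurable_fun D (fun s => (seg a b s ^+ 2)^-1).
Proof.
apply: measurable_funTS.
under eq_fun do rewrite -powR_inv1 ?sqr_ge0//.
apply: measurable_powR_comp; rewrite /seg; apply: measurable_funX; apply: measurable_funD.
  exact: measurable_funM.
by apply: measurable_funM => //; exact: measurable_onem.
Qed.

Lemma integrable_segV2 (g : R -> R) (M : R) : measurable_fun `[0 : R, 1] g ->
  (forall s : R, 0 <= s <= 1 -> `|g s| <= M) ->
  mu.-integrable `[0, 1] (EFin \o (fun s => g s / seg a b s ^+ 2)).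
Proof.
move=> mg gM; apply: (integrable_bounded01 _ (M * a ^- 2)).
  by apply: measurable_funM => //; exact: measurable_segV2.
move=> s s01; rewrite normrM; apply: ler_pM => //; first exact: gM.
rewrite normfV ger0_norm ?sqr_ge0// lef_pV2 ?posrE ?exprn_gt0 ?seg_gt0//.
by rewrite lerXn2r ?nnegrE ?seg_ge// ltW// seg_gt0.
Qed.

Let mI : measurable (`[0, 1]%classic : set (measurableTypeR R)).
Proof. exact: measurable_itv. Qed.

(** This is why the reflection [s -> 1 - s] turns Euler's integral with argument [1 - a/b] into one
    against [1 / seg^2], at the cost of a factor [b^2]. *)
Let seg_reflect (s : R) : 1 - (1 - a / b) * s = seg a b (1 - s) / b.
Proof. by rewrite /seg; field; rewrite gt_eqF. Qed.

Let Rintegral_reflectZ (k : R) (h h' : R -> R) (M : R) :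
  measurable_fun `[0 : R, 1] h -> (forall s : R, 0 <= s <= 1 -> `|h s| <= M) ->
  (forall s : R, 0 <= s <= 1 -> h' s = k * (h (1 - s) / seg a b (1 - s) ^+ 2)) ->
  \int[mu]_(s in `[0, 1]) h' s =
  k * \int[mu]_(s in `[0, 1]) (h s / seg a b s ^+ 2).
Proof.
move=> mh hM hh'; rewrite -RintegralZl//; last exact: integrable_segV2 mh hM.
rewrite [RHS]Rintegral01_reflect.
  by apply: eq_Rintegral => s; rewrite inE /= in_itv /= => /hh'.
by do 2 apply: measurable_funM => //; exact: measurable_segV2.
Qed.

(** The prefactor [1 / (p + 1)] is [Beta 1 (p + 1)], the normalisation of this hypergeometric
    function. *)
Let C5_term1 (p : R) : 0 <= p ->
  b ^- 2 / (p + 1) * Hyp2F1 2 1 (p + 2) (1 - a / b) =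
  \int[mu]_(s in `[0, 1]) (s `^ p / seg a b s ^+ 2).
Proof.
move=> p0; have p1 : 0 < p + 1 by lra.
rewrite -mulrA -(Beta1 _ p1) Hyp2F1_Beta; [|by rewrite Beta1// invr_neq0// gt_eqF|by ring].
rewrite (Rintegral_reflectZ (b ^+ 2) (fun s => s `^ p) _ 1).
- by rewrite mulKf// expf_neq0// gt_eqF.
- exact: measurable_powR_comp.
- by move=> s s01; rewrite ger0_norm ?powR_ge0// powR_le1.
move=> s s01; have sg : 0 < seg a b (1 - s) by apply: seg_gt0; lra.
rewrite seg_reflect subrr powRr0 mul1r addrK powR_invn; last by rewrite divr_ge0 ?ltW.
by field; rewrite !gt_eqF.
Qed.

Let C5_term2 (al : R) : 0 <= al ->
  Beta (th + 1) (al + 1) / b ^+ 2 * Hyp2F1 2 (th + 1) (th + al + 2) (1 - a / b) =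
  \int[mu]_(s in `[0, 1]) (s `^ al * (1 - s) `^ th / seg a b s ^+ 2).
Proof.
move=> al0; have B0 := Beta_gt0 _ _ (ltW th0) al0.
rewrite mulrAC Hyp2F1_Beta; [|by rewrite gt_eqF|by ring].
rewrite (Rintegral_reflectZ (b ^+ 2) (fun s => s `^ al * (1 - s) `^ th) _ 1).
- by rewrite mulrC mulKf// expf_neq0// gt_eqF.
- apply: measurable_funM; apply: measurable_powR_comp => //.
  exact: measurable_onem.
- move=> s s01; rewrite ger0_norm ?mulr_ge0 ?powR_ge0// mulr_ile1 ?powR_ge0//;
    apply: powR_le1; rewrite ?(ltW th0)//; lra.
move=> s s01; have sg : 0 < seg a b (1 - s) by apply: seg_gt0; lra.
rewrite seg_reflect !addrK subKr powR_invn; last by rewrite divr_ge0 ?ltW.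
by field; rewrite !gt_eqF.
Qed.

Let measurable_max (D : set R) :
  measurable_fun D (fun s : R => Num.max (1 - 2 * s) 0).
Proof.
apply: measurable_funTS; apply: measurable_maxr => //.
by apply: measurable_funB => //; exact: measurable_funM.
Qed.

Let max_01 (s : R) : 0 <= s <= 1 -> 0 <= Num.max (1 - 2 * s) 0 <= 1.
Proof. by move=> s01; rewrite maxEle; case: ifPn; rewrite -?ltNge; lra. Qed.

(** The substitution [s = (1 - u) / 2] maps [[0, 1/2]] to [[0, 1]]; it turns [1 - 2 s] into [u],
    [s^al] into [2^(-al) (1 - u)^al], and [seg a b s] into [(a + b)/2] times
    [1 - u (b - a)/(b + a)]. *)
Let C5_term3 (al : R) : 0 <= al ->
  Beta (th + 1) (al + 1) / ((a + b) ^+ 2 * 2 `^ (al - 2))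
      * Hyp2F1 2 (th + 1) (th + al + 2) ((b - a) / (b + a)) =
  \int[mu]_(s in `[0, 1])
    (s `^ al * (2 * Num.max (1 - 2 * s) 0 `^ th) / seg a b s ^+ 2).
Proof.
move=> al0; have B0 := Beta_gt0 _ _ (ltW th0) al0.
rewrite mulrAC Hyp2F1_Beta; [|by rewrite gt_eqF|by ring].
pose G s := s `^ al * (2 * Num.max (1 - 2 * s) 0 `^ th) / seg a b s ^+ 2.
rewrite -[RHS]/(\int[mu]_(s in `[0, 1]) G s).
have mG (D : set R) : measurable_fun D G.
  apply: measurable_funM; last exact: measurable_segV2.
  apply: measurable_funM; first exact: measurable_powR_comp.
  by apply: measurable_funM => //; exact: measurable_powR_comp.
(* Beyond [1/2] the maximum is 0, and [0^th = 0] because [th > 0]. *)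
have half : \int[mu]_(s in `[0, 1]) G s = \int[mu]_(s in `[0, 2^-1]) G s.
  rewrite Rintegral_mkcond [RHS]Rintegral_mkcond.
  apply: eq_Rintegral => s _; rewrite !patchE.
  have [s12|s12] := leP s 2^-1.
    congr (if _ then _ else _); apply/idP/idP; rewrite !inE /= !in_itv /=; lra.
  rewrite (_ : (s \in `[0, 2^-1]%classic) = false); last first.
    by apply/negP; rewrite inE /= in_itv /=; lra.
  case: ifP => // _; rewrite /G max_r; last by lra.
  by rewrite powR0 ?gt_eqF// !(mulr0, mul0r).
have h0 : 0 < 2^-1 :> R by [].
rewrite half (Rintegral_itv01_rev _ 0 2^-1 h0)// subr0.
have int1 : mu.-integrable `[0, 1] (EFin \o (fun s => G (2^-1 - 2^-1 * s))).
  apply: (integrable_bounded01 _ (2 * a ^- 2)).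
    apply: (@measurableT_comp _ _ _ _ _ _ G) => //.
    by apply: measurable_funTS; apply: measurable_funB => //; exact: measurable_funM.
  move=> s s01; set u := _ - _; have u01 : 0 <= u <= 1 by rewrite /u; lra.
  have sg := seg_gt0 _ u01.
  rewrite /G !normrM; apply: ler_pM; rewrite ?mulr_ge0//.
    rewrite -[leRHS]mul1r; apply: ler_pM; rewrite ?mulr_ge0//.
      by rewrite ger0_norm ?powR_ge0// powR_le1.
    rewrite normr_nat -[leRHS]mulr1 ler_wpM2l// ger0_norm ?powR_ge0// powR_le1 ?max_01//.
    exact: ltW.
  rewrite normfV ger0_norm ?sqr_ge0// lef_pV2 ?posrE ?exprn_gt0//.
  by rewrite lerXn2r ?nnegrE ?seg_ge// ltW.
have k0 : 0 < (a + b) ^+ 2 * 2 `^ (al - 2).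
  by rewrite mulr_gt0 ?powR_gt0// exprn_gt0// addr_gt0.
rewrite -RintegralZl//.
apply: (mulIf (lt0r_neq0 k0)); rewrite /= divfK ?gt_eqF//.
rewrite [RHS]mulrC -RintegralZl//; last first.
  by have := integrableZl mI 2^-1 int1; apply: eq_integrable.
apply: eq_Rintegral => s; rewrite inE /= in_itv /= => s01.
have sg : 0 < seg a b (2^-1 - 2^-1 * s) by apply: seg_gt0; lra.
have e : 1 - (b - a) / (b + a) * s = 2 * seg a b (2^-1 - 2^-1 * s) / (a + b).
  by rewrite /seg; field; rewrite gt_eqF// addr_gt0.
rewrite e !addrK powR_invn; last first.
  by apply: divr_ge0; [apply: mulr_ge0|apply: addr_ge0] => //; exact: ltW.
rewrite /G (_ : 1 - 2 * (2^-1 - 2^-1 * s) = s); last by field.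
rewrite max_l; last by case/andP: s01.
have -> : (2^-1 - 2^-1 * s) `^ al = 2^-1 `^ al * (1 - s) `^ al.
  by rewrite -powRM//; [congr (_ `^ _); ring|lra].
rewrite powRB; last by apply/implyP => _; rewrite pnatr_eq0.
have -> : 2^-1 `^ al = (2 `^ al)^-1 :> R.
  by rewrite -[in LHS]powR_inv1// -powRrM mulN1r powRN.
rewrite (powR_mulrn 2)//; have p2 : 0 < 2 `^ al :> R by rewrite powR_gt0.
by field; rewrite !gt_eqF// addr_gt0.
Qed.

Let powRM_ge0_le1 (al p s s' : R) : 0 <= al -> 0 <= p -> 0 <= s <= 1 -> 0 <= s' <= 1 ->
  `|s `^ al * s' `^ p| <= 1.
Proof.
by move=> *; rewrite ger0_norm ?mulr_ge0 ?powR_ge0// mulr_ile1 ?powR_ge0 ?powR_le1.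
Qed.

Lemma C5E (al : R) : 0 <= al ->
  C5 th al a b = \int[mu]_(s in `[0, 1]) (s `^ al * wbar s).
Proof.
move=> al0; have th0' := ltW th0.
have p0 : 0 <= th + al by rewrite addr_ge0.
rewrite /C5 C5_term1// C5_term2// C5_term3//.
have i1 : mu.-integrable `[0, 1] (EFin \o (fun s => s `^ (th + al) / seg a b s ^+ 2)).
  apply: (integrable_segV2 _ 1); first exact: measurable_powR_comp.
  by move=> s s01; rewrite ger0_norm ?powR_ge0// powR_le1.
have i2 : mu.-integrable `[0, 1]
    (EFin \o (fun s => s `^ al * (1 - s) `^ th / seg a b s ^+ 2)).
  apply: (integrable_segV2 _ 1).
    apply: measurable_funM; apply: measurable_powR_comp => //.
    exact: measurable_onem.
  by move=> s s01; apply: powRM_ge0_le1 => //; lra.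
have i3 : mu.-integrable `[0, 1] (EFin \o (fun s =>
    s `^ al * (2 * Num.max (1 - 2 * s) 0 `^ th) / seg a b s ^+ 2)).
  apply: (integrable_segV2 _ 2).
    apply: measurable_funM; first exact: measurable_powR_comp.
    by apply: measurable_funM => //; exact: measurable_powR_comp.
  move=> s s01; rewrite mulrCA normrM normr_nat -[leRHS]mulr1 ler_wpM2l//.
  by apply: powRM_ge0_le1 => //; exact: max_01.
rewrite -RintegralB// -RintegralD//; last first.
  by have := integrableB mI i1 i2; apply: eq_integrable.
apply: eq_Rintegral => s _; rewrite /wbar powRD.
  by ring.
by rewrite gt_eqF// ltr_wpDr.
Qed.

Lemma C4E : C4 th a b = \int[mu]_(s in `[0, 1]) wbar s.
Proof.
(* [C4] is [C5] at exponent 0: [s^0 = 1] even at [s = 0], and [Beta (th + 1) 1 = 1 / (th + 1)]. *)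
transitivity (C5 th 0 a b); last first.
  by rewrite C5E//; apply: eq_Rintegral => s _; rewrite powRr0 mul1r.
have th1 : 0 < th + 1 by rewrite addr_gt0.
have B1 : Beta (th + 1) 1 = (th + 1)^-1.
  rewrite -(Beta1 _ th1) /Beta [RHS]Rintegral01_reflect; last first.
    apply: measurable_funM; first exact: measurable_powR_comp.
    by apply: measurable_powR_comp; exact: measurable_onem.
  by apply: eq_Rintegral => s _; rewrite subKr mulrC.
rewrite /C4 /C5 !addr0 add0r B1 sub0r powRN (powR_mulrn 2)//.
have abn : a + b != 0 by rewrite gt_eqF// addr_gt0.
congr (_ - _ * _ + _ * _); by field; rewrite ?abn ?(gt_eqF b0) ?(gt_eqF th1).
Qed.

End hypergeometric_constants.

(** * Integration by parts against the fractional kernels *)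

Section fractional_by_parts.
Context {R : realType}.
Local Notation mu := (@lebesgue_measure R).

Lemma is_derive_onem (F : R -> R) (s l : R) : is_derive (1 - s) 1 F l ->
  is_derive s 1 (fun s => F (1 - s)) (- l).
Proof.
move=> dF; rewrite -[- l]mulrN1.
apply: (@is_derive1_comp _ F (fun s => 1 - s)) => //.
rewrite -[-1]add0r; exact: is_deriveB.
Qed.

Variables (F g : R -> R) (th M : R).
Hypotheses (th0 : 0 < th).
Hypothesis dF : forall s : R, 0 <= s <= 1 -> is_derive s 1 F (g s).
Hypothesis gM : forall s : R, 0 <= s <= 1 -> `|g s| <= M.
Hypothesis mg : measurable_fun `[0 : R, 1] g.

Let cF (s : R) : 0 <= s <= 1 -> {for s, continuous F}.
Proof. by move=> s01; apply: is_derive_continuous; exact: dF. Qed.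

Lemma is_derive_measurable01 : measurable_fun `[0 : R, 1] F.
Proof.
apply: subspace_continuous_measurable_fun => //.
apply: continuous_in_subspaceT => s; rewrite inE /= in_itv /=; exact: cF.
Qed.

Let mF := is_derive_measurable01.

Let M0 : 0 <= M.
Proof. by apply: le_trans (gM 0 _); rewrite ?normr_ge0// lexx ler01. Qed.

Let FM : exists2 C : R, 0 <= C & forall s : R, 0 <= s <= 1 -> `|F s| <= C.
Proof.
exists (`|F 0| + M); first by rewrite addr_ge0.
move=> s /andP[s0 s1]; rewrite -[F s](subrK (F 0)) (le_trans (ler_normD _ _))//.
rewrite addrC lerD2l.
apply: le_trans (is_derive_lipschitz F g 0 1 M 0 s dF gM _ _ _) _ => //.
by rewrite subr0 ler_piMr.
Qed.

Let kern (s : R) := s `^ (th - 1) + (1 - s) `^ (th - 1).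
Let ker (s : R) := s `^ th - (1 - s) `^ th.

Let mI : measurable (`[0, 1]%classic : set (measurableTypeR R)).
Proof. exact: measurable_itv. Qed.

(** The reflection [t -> 1 - t] carries the integral of the modulus to that of [t^(th-1)]. *)
Lemma integrable_powR_onem : mu.-integrable `[0, 1] (EFin \o (fun t => (1 - t) `^ (th - 1))).
Proof.
have m1 (D : set R) : measurable_fun D (fun t : R => (1 - t) `^ (th - 1)).
  by apply: measurable_powR_comp; exact: measurable_onem.
have /integrableP[_ i1] := integrable_powR th th0.
apply/integrableP; split; first by apply/measurable_EFinP; exact: m1.
have N1 : -1 != 0 :> R by rewrite oppr_eq0 oner_eq0.
rewrite (@integral_affine R (-1) 1 N1) in i1 => //; last first.
  by apply: measurableT_comp => //; apply/measurable_EFinP; exact: measurable_powR_comp.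
rewrite normrN1 mul1e in i1.
rewrite (_ : [set x | _] = `[0, 1]%classic) in i1; last first.
  by apply/seteqP; split => x /=; rewrite !in_itv /=; lra.
rewrite (_ : (\int[mu]_(x in _) _ = \int[mu]_(x in `[0%R, 1%R])
  `|(EFin \o powR (R:=R) ^~ (th - 1)%R) (-1 * x + 1)%R|)%E)//.
by apply: eq_integral => x _ /=; rewrite mulN1r addrC.
Qed.

Lemma integrable_powR_bounded :
  mu.-integrable `[0, 1] (EFin \o (fun s => s `^ (th - 1) * F s)) /\
  mu.-integrable `[0, 1] (EFin \o (fun s => (1 - s) `^ (th - 1) * F s)).
Proof.
have [C C0 FC] := FM.
split.
  have := integrableZl mI C (integrable_powR th th0).
  apply: le_integrable => //.
    apply/measurable_EFinP; apply: measurable_funM => //; exact: measurable_powR_comp.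
  move=> s; rewrite /= in_itv /= => s01; rewrite lee_fin !normrM mulrC ler_wpM2r//.
  by rewrite (ger0_norm C0) FC.
have := integrableZl mI C integrable_powR_onem.
apply: le_integrable => //.
  apply/measurable_EFinP; apply: measurable_funM => //; apply: measurable_powR_comp.
  exact: measurable_onem.
move=> s; rewrite /= in_itv /= => s01; rewrite lee_fin !normrM mulrC ler_wpM2r//.
by rewrite (ger0_norm C0) FC.
Qed.

Let measurable_ker (D : set R) : measurable_fun D ker.
Proof.
apply: measurable_funB; apply: measurable_powR_comp => //; exact: measurable_onem.
Qed.

Lemma ker_le1 (s : R) : 0 <= s <= 1 -> `|s `^ th - (1 - s) `^ th| <= 1.
Proof.
move=> s01; have h1 : s `^ th <= 1 by apply: powR_le1 => //; exact: ltW.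
have h2 : (1 - s) `^ th <= 1 by apply: powR_le1; [exact: ltW|lra].
have h3 := powR_ge0 s th; have h4 := powR_ge0 (1 - s) th.
by rewrite ler_norml; lra.
Qed.

Lemma integrable_ker : mu.-integrable `[0, 1] (EFin \o (fun s => (s `^ th - (1 - s) `^ th) * g s)).
Proof.
apply: (integrable_bounded01 _ M); first exact: measurable_funM.
move=> s s01; rewrite normrM -[leRHS]mul1r; apply: ler_pM => //.
  exact: ker_le1.
exact: gM.
Qed.

Let is_derive_ker (s : R) : 0 < s < 1 -> is_derive s 1 ker (th * kern s).
Proof.
move=> /andP[s0 s1].
have d1 := is_derive1_powR th s0.
have s1' : 0 < 1 - s by lra.
have d2 := is_derive_onem _ s _ (is_derive1_powR th s1').
by apply: is_derive_eq (is_deriveB d1 d2) _; rewrite /kern; ring.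
Qed.

Let integrand (s : R) := ker s * g s + F s * (th * kern s).

(** Product rule for [ker * F]. The derivative of [ker] may blow up at 0 and 1, but away from them
    [FTC2_bounded] applies. *)
Let integral_eps n : \int[mu]_(s in `[eps n, 1 - eps n]) integrand s =
  ker (1 - eps n) * F (1 - eps n) - ker (eps n) * F (eps n).
Proof.
have e0 := @eps_gt0 R n; have e1 := @eps_lt_half R n; have [C C0 FC] := FM.
(* Write [x^(th-1) = x^th / x] with [x^th <= 1]. *)
have powle x : eps n <= x <= 1 -> `|x `^ (th - 1)| <= (eps n)^-1.
  move=> /andP[ex x1]; have x0 : 0 < x by apply: lt_le_trans ex.
  rewrite ger0_norm ?powR_ge0// powRB; last by rewrite (gt_eqF x0) implybT.
  rewrite powRr1 ?(ltW x0)// -[leRHS]mul1r; apply: ler_pM; rewrite ?powR_ge0//.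
  - by rewrite invr_ge0 ltW.
  - by rewrite powR_le1 ?(ltW th0)// (ltW x0).
  - by rewrite lef_pV2.
apply: (FTC2_bounded (fun s => ker s * F s) integrand _ _
  (M + C * (th * ((eps n)^-1 + (eps n)^-1)))).
- by lra.
- move=> z z01; have d1 : is_derive z 1 ker (th * kern z) by apply: is_derive_ker; lra.
  have d2 : is_derive z 1 F (g z) by apply: dF; lra.
  by apply: is_derive_eq (is_deriveM d1 d2) _; rewrite /integrand /GRing.scale /=; ring.
- move=> z z01; have z01' : 0 <= z <= 1 by lra.
  rewrite /integrand (le_trans (ler_normD _ _))// lerD//.
    by rewrite normrM -[leRHS]mul1r; apply: ler_pM; rewrite ?ker_le1 ?gM.
  rewrite normrM; apply: ler_pM; rewrite ?FC// normrM (gtr0_norm th0) ler_wpM2l ?(ltW th0)//.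
  by rewrite (le_trans (ler_normD _ _))// lerD// powle//; lra.
- have sub : `[eps n, 1 - eps n] `<=` `[0 : R, 1].
    exact: subset_trans (@subset_eps01 R n) (@subset_itv_oo_cc _ _ 0 1).
  apply: measurable_funD; apply: measurable_funM.
  + exact: measurable_ker.
  + by apply: measurable_funS mg.
  + by apply: measurable_funS mF.
  + apply: measurable_funM => //; apply: measurable_funD; apply: measurable_powR_comp => //.
    exact: measurable_onem.
Qed.

Let integrable_kern : mu.-integrable `[0, 1] (EFin \o (fun s => F s * (th * kern s))).
Proof.
have [i1 i2] := integrable_powR_bounded.
have := integrableZl mI th (integrableD mI i1 i2); apply: eq_integrable => // s _ /=.
by rewrite -EFinD -EFinM /kern; congr EFin; ring.
Qed.

Let cvg_1eps : 1 - eps n @[n --> \oo] --> (1 : R).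
Proof.
by rewrite -[X in _ --> X]subr0; apply: cvgB; [exact: cvg_cst|exact: cvg_eps].
Qed.

Let cvg_F0 : F (eps n) @[n --> \oo] --> F 0.
Proof.
by apply: continuous_cvg; [apply: cF; rewrite lexx ler01|exact: cvg_eps].
Qed.

Let cvg_F1 : F (1 - eps n) @[n --> \oo] --> F 1.
Proof.
by apply: continuous_cvg; [apply: cF; rewrite lexx ler01|exact: cvg_1eps].
Qed.

Let cvg_integral_eps :
  ker (1 - eps n) * F (1 - eps n) - ker (eps n) * F (eps n) @[n --> \oo] --> F 1 + F 0.
Proof.
(* The kernel tends to 1 at 1 and to -1 at 0, so the two boundary terms add up. *)
have -> : F 1 + F 0 = (1 - 0) * F 1 - (0 - 1) * F 0 by ring.
apply: cvgB; apply: cvgM => //; apply: cvgB.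
- exact: cvg_powR_1eps.
- by under eq_fun do rewrite subKr; exact: cvg_powR_eps.
- exact: cvg_powR_eps.
- exact: cvg_powR_1eps.
Qed.

Lemma fractional_by_parts :
  th * (\int[mu]_(s in `[0, 1]) (s `^ (th - 1) * F s) +
        \int[mu]_(s in `[0, 1]) ((1 - s) `^ (th - 1) * F s)) =
  F 1 + F 0 - \int[mu]_(s in `[0, 1]) ((s `^ th - (1 - s) `^ th) * g s).
Proof.
have [i1 i2] := integrable_powR_bounded.
have iD : mu.-integrable `[0, 1] (EFin \o integrand).
  by have := integrableD mI integrable_ker integrable_kern.
have ioo : mu.-integrable `]0, 1[ (EFin \o integrand).
  by apply: integrableS iD => //; exact: subset_itv_oo_cc.
have c := cvg_integral_exhaust _ _ _ (measurable_itv _) subset_eps01 near_itv01 _ ioo.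
have -> : F 1 + F 0 = \int[mu]_(s in `[0, 1]) integrand s.
  have -> : \int[mu]_(s in `[0, 1]) integrand s = \int[mu]_(s in `]0, 1[) integrand s.
    by rewrite /Rintegral integral_itv_bndoo//; exact: measurable_int ioo.
  apply: (cvg_unique _ cvg_integral_eps : _ -> F 1 + F 0 = _) => //.
  have -> : (fun n => ker (1 - eps n) * F (1 - eps n) - ker (eps n) * F (eps n)) =
    (fun n => \int[mu]_(s in `[eps n, 1 - eps n]) integrand s) => //.
  by apply/funext => n; rewrite integral_eps.
rewrite RintegralD//; last exact: integrable_ker.
rewrite addrAC subrr add0r -RintegralD// -RintegralZl//.
  by apply: eq_Rintegral => s _; rewrite /kern; ring.
by have := integrableD mI i1 i2.
Qed.

End fractional_by_parts.

(** * The integral identity for [Ifrac] *)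

Section fractional_identity.
Context {R : realType}.
Local Notation mu := (@lebesgue_measure R).
Variables (f f' : R -> R) (a b th M : R).
Hypotheses (a0 : 0 < a) (ab : a < b) (th01 : 0 < th <= 1).
Hypothesis df : forall x : R, a <= x <= b -> is_derive x 1 f (f' x).
Hypothesis f'M : forall x : R, a <= x <= b -> `|f' x| <= M.
Hypothesis mf' : measurable_fun `[a, b] f'.

Let b0 : 0 < b. Proof. exact: lt_trans ab. Qed.
Let th0 : 0 < th. Proof. by case/andP: th01. Qed.

Lemma seg_itv (s : R) : 0 <= s <= 1 -> a <= a * b / seg a b s <= b.
Proof.
move=> s01; have sg := seg_gt0 _ _ a0 ab _ s01.
rewrite ler_pdivlMr// ler_pdivrMr//.
rewrite ler_pM2l// (mulrC a b) ler_pM2l//.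
by rewrite (seg_le _ _ a0 ab)// (seg_ge _ _ a0 ab).
Qed.

Lemma is_derive_seg (s : R) : is_derive s 1 (seg a b) (b - a).
Proof.
have -> : seg a b = (fun s => (b - a) *: s + a) by apply/funext => x; rewrite /seg /GRing.scale /=; ring.
have d := @is_deriveZ R R _ id (b - a) s 1 1 (is_derive_id s 1).
by apply: is_derive_eq (is_deriveD d (is_derive_cst a s 1)) _; rewrite addr0 /GRing.scale /= mulr1.
Qed.

Lemma is_derive_f_seg (s : R) : 0 <= s <= 1 ->
  is_derive s 1 (fun s => f (a * b / seg a b s))
    (- (a * b * (b - a)) * (f' (a * b / seg a b s) / seg a b s ^+ 2)).
Proof.
move=> s01; have sg := seg_gt0 _ _ a0 ab _ s01.
have sgn : seg a b s != 0 by rewrite gt_eqF.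
have d1 := df _ (seg_itv _ s01).
have d2 := is_deriveZ (a * b) (is_deriveV sgn (is_derive_seg s)).
apply: is_derive_eq (is_derive1_comp (g := fun s => a * b *: (seg a b s)^-1) d1 d2) _.
by rewrite /GRing.scale /=; field.
Qed.

Lemma measurable_f_seg :
  measurable_fun `[0 : R, 1] (fun s => f' (a * b / seg a b s)).
Proof.
apply: (measurable_comp (F := `[a, b])) => //.
  by move=> _ [s s01 <-]; rewrite /= in_itv /=; apply: seg_itv; rewrite /= in_itv in s01.
apply: measurable_funM => //.
(* Reduces to [measurable_segV2]; the equality also holds where [seg] vanishes, as [0^-1 = 0]. *)
have -> : (fun s : R => (seg a b s)^-1) = (fun s => seg a b s * (seg a b s ^+ 2)^-1).
  apply/funext => s; have [->|s0] := eqVneq (seg a b s) 0.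
    by rewrite invr0 mul0r.
  by field.
apply: measurable_funM; last exact: measurable_segV2.
apply: measurable_funTS; apply: measurable_funD; first exact: measurable_funM.
by apply: measurable_funM => //; exact: measurable_onem.
Qed.

Let L := a^-1 - b^-1.

Let L0 : 0 < L. Proof. by rewrite subr_gt0 ltf_pV2. Qed.

(** The affine parametrisation of [[1/b, 1/a]] is thus the substitution [t = B s / (a b)]. *)
Let segE (s : R) : L * s + b^-1 = seg a b s / (a * b).
Proof. by rewrite /L /seg; field; rewrite !gt_eqF. Qed.

Let measurable_phi : measurable_fun `[b^-1, a^-1] (f \o @ginv R).
Proof.
apply: subspace_continuous_measurable_fun => //.
apply: continuous_in_subspaceT => x; rewrite inE /= in_itv /= => /andP[bx xa].
have x0 : 0 < x by apply: lt_le_trans bx; rewrite invr_gt0.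
apply: continuous_comp; first by apply: inv_continuous; rewrite gt_eqF.
apply: is_derive_continuous; apply: df.
rewrite /ginv -[a]invrK -[b]invrK.
by rewrite !lef_pV2 ?posrE ?invr_gt0// xa bx.
Qed.

Let Lb : b^-1 < a^-1. Proof. by rewrite ltf_pV2. Qed.

Let phiE (s : R) : 0 <= s <= 1 -> (f \o @ginv R) (L * s + b^-1) = f (a * b / seg a b s).
Proof. by move=> s01; rewrite /= /ginv segE invf_div. Qed.


Lemma IfracE : Ifrac f th a b = - (a * b * (b - a) / 2) *
  \int[mu]_(s in `[0, 1])
    ((s `^ th - (1 - s) `^ th) * (f' (a * b / seg a b s) / seg a b s ^+ 2)).
Proof.
pose F s := f (a * b / seg a b s).
pose g s := - (a * b * (b - a)) * (f' (a * b / seg a b s) / seg a b s ^+ 2).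
pose C := a * b * (b - a).
have C0 : 0 < C by rewrite !mulr_gt0// subr_gt0.
have M0 : 0 <= M by apply: le_trans (f'M a _); rewrite ?normr_ge0// lexx ltW.
have mh : measurable_fun `[0 : R, 1] (fun s => f' (a * b / seg a b s) / seg a b s ^+ 2).
  by apply: measurable_funM; [exact: measurable_f_seg|exact: measurable_segV2].
have mg : measurable_fun `[0 : R, 1] g by exact: measurable_funM.
have hM (s : R) : 0 <= s <= 1 -> `|f' (a * b / seg a b s) / seg a b s ^+ 2| <= M * a ^- 2.
  move=> s01; have sg := seg_gt0 _ _ a0 ab _ s01.
  rewrite normrM; apply: ler_pM => //; first by apply: f'M; exact: seg_itv.
  rewrite normfV ger0_norm ?sqr_ge0// lef_pV2 ?posrE ?exprn_gt0//.
  by rewrite lerXn2r ?nnegrE ?(seg_ge _ _ a0 ab)// ltW.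
have gM (s : R) : 0 <= s <= 1 -> `|g s| <= C * (M * a ^- 2).
  by move=> s01; rewrite /g normrM normrN -/C (gtr0_norm C0) ler_wpM2l ?hM// ltW.
have parts := fractional_by_parts F g th _ th0 is_derive_f_seg gM mg.
have [i1 i2] := integrable_powR_bounded F g th _ th0 is_derive_f_seg gM.
(* The Jacobian [L] joins the factor [L^(th-1)] of the kernel, since [t - 1/b = L s] and
   [1/a - t = L (1 - s)]. *)
have LL : L * L `^ (th - 1) = L `^ th by rewrite mulr_powRB1// ltW.
have eR : RL_right th (f \o @ginv R) a^-1 b^-1 =
    (Gamma th)^-1 * (L `^ th * \int[mu]_(s in `[0, 1]) (s `^ (th - 1) * F s)).
  rewrite /RL_right (Rintegral_itv01 _ _ _ Lb); last first.
    apply: measurable_funM => //; apply: measurable_powR_comp.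
    by apply: measurable_funTS; exact: measurable_funB.
  rewrite -/L -LL -[in RHS]mulrA; congr (_ * (_ * _)); rewrite -RintegralZl//.
  apply: eq_Rintegral => s; rewrite inE /= in_itv /= => s01.
  rewrite -[f _]/((f \o @ginv R) (L * s + b^-1)) phiE// addrK powRM ?(ltW L0)//.
    by rewrite mulrA.
  by case/andP: s01.
have eL : RL_left th (f \o @ginv R) b^-1 a^-1 =
    (Gamma th)^-1 * (L `^ th * \int[mu]_(s in `[0, 1]) ((1 - s) `^ (th - 1) * F s)).
  rewrite /RL_left (Rintegral_itv01 _ _ _ Lb); last first.
    apply: measurable_funM => //; apply: measurable_powR_comp.
    by apply: measurable_funTS; exact: measurable_funB.
  rewrite -/L -LL -[in RHS]mulrA; congr (_ * (_ * _)); rewrite -RintegralZl//.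
  apply: eq_Rintegral => s; rewrite inE /= in_itv /= => s01.
  rewrite -[f _]/((f \o @ginv R) (L * s + b^-1)) phiE//.
  have -> : a^-1 - (L * s + b^-1) = L * (1 - s) by rewrite /L; ring.
  rewrite powRM ?(ltW L0)//; last by lra.
  by rewrite mulrA.
have Gth := Gamma_gt0 _ th01.
(* [L] is [(b - a) / (a b)]. *)
have abL : (a * b / (b - a)) `^ th * L `^ th = 1.
  rewrite -powRM ?(ltW L0)//; last by rewrite divr_ge0 ?mulr_ge0 ?subr_ge0 ?ltW.
  rewrite (_ : _ * L = 1) ?powR1// /L.
  by field; rewrite !gt_eqF// subr_gt0.
rewrite /Ifrac eR eL GammaD1//.
set I1 := \int[mu]_(s in `[0, 1]) (s `^ (th - 1) * F s) in parts *.
set I2 := \int[mu]_(s in `[0, 1]) ((1 - s) `^ (th - 1) * F s) in parts *.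
(* After the Gamma values cancel, the remaining factor [th] is the one in [fractional_by_parts]. *)
have -> : th * Gamma th / 2 * (a * b / (b - a)) `^ th *
    ((Gamma th)^-1 * (L `^ th * I1) + (Gamma th)^-1 * (L `^ th * I2)) =
    ((a * b / (b - a)) `^ th * L `^ th) * (th * (I1 + I2)) / 2.
  by field; rewrite gt_eqF.
rewrite abL mul1r parts.
have -> : F 0 = f b by rewrite /F /seg; congr f; field; rewrite gt_eqF.
have -> : F 1 = f a by rewrite /F /seg; congr f; field; rewrite gt_eqF.
have -> : \int[mu]_(s in `[0, 1]) ((s `^ th - (1 - s) `^ th) * g s) =
   - C * \int[mu]_(s in `[0, 1])
    ((s `^ th - (1 - s) `^ th) * (f' (a * b / seg a b s) / seg a b s ^+ 2)).
  rewrite -RintegralZl//; last exact: (integrable_ker _ _ _ th0 hM mh).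
  by apply: eq_Rintegral => s _; rewrite /g /C; ring.
by rewrite /C; field.
Qed.

End fractional_identity.

(** * Subadditivity of powers and Young's inequality with a parameter *)

Section power_inequalities.
Context {R : realType}.

Lemma powR_subadditive (p x y : R) : 0 < p <= 1 -> 0 <= x -> 0 <= y ->
  (x + y) `^ p <= x `^ p + y `^ p.
Proof.
move=> /andP[p0 p1] x0 y0.
have [/eqP|xy0] := eqVneq (x + y) 0.
  by rewrite paddr_eq0// => /andP[/eqP -> /eqP ->]; rewrite addr0 lerDl powR_ge0.
have z0 : 0 < x + y by rewrite lt_neqAle eq_sym xy0 addr_ge0.
(* A number in [[0, 1]] is at most its [p]-th power; summing over [u = x] and [u = y] gives 1 on the
   left. *)
have le_powR u : 0 <= u -> u <= x + y -> u / (x + y) <= u `^ p / (x + y) `^ p.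
  move=> u0 ule; have [->|un0] := eqVneq u 0; first by rewrite mul0r divr_ge0 ?powR_ge0.
  rewrite -(powR_inv1 (powR_ge0 _ _)) -powRAC -powRM ?powR_ge0// powR_inv1 ?(ltW z0)//.
  have u1 : 0 < u by rewrite lt_neqAle eq_sym un0.
  by apply: ger1_powR => //; rewrite divr_gt0//= ler_pdivrMr// mul1r.
have := lerD (le_powR x x0 _) (le_powR y y0 _).
rewrite -!mulrDl divff// lerDl lerDr => /(_ y0 x0).
by rewrite ler_pdivlMr ?powR_gt0// mul1r.
Qed.

(** Young's inequality for [l h] and [1], divided by [l]. The case [q = 1], where no finite
    conjugate exponent exists, is an equality. *)
Lemma powR_young (h l q : R) : 0 <= h -> 0 < l -> 1 <= q ->
  h <= l `^ (q - 1) / q * h `^ q + (1 - q^-1) / l.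
Proof.
move=> h0 l0; rewrite le_eqVlt => /predU1P[<-|q1].
  by rewrite subrr powRr0 invr1 mulr1 mul1r powRr1// subrr mul0r addr0.
have q0 : 0 < q by lra.
have r0 : 0 < 1 - q^-1 by rewrite subr_gt0 invf_lt1.
have := @conjugate_powR R (l * h) 1 q (1 - q^-1)^-1.
rewrite invrK subrKC powR1 mul1r mulr1 => /(_ (mulr_ge0 (ltW l0) h0) ler01 q0).
rewrite invr_gt0 => /(_ r0 erefl).
rewrite powRM ?(ltW l0)// -(mulr_powRB1 (ltW l0) q0) => yg.
rewrite -(ler_pM2l l0) (le_trans yg)// le_eqVlt; apply/orP; left; apply/eqP.
by field; rewrite !gt_eqF.
Qed.

(** The minimum over [l] is attained at [l = (C / N)^(1/q)]. For [N = 0], a positive [X] is refuted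
    by [l = C / X], which yields [X <= (1 - 1/q) X]. *)
Lemma le_powR_young_optimal (X C N q : R) : 1 <= q -> 0 < C -> 0 <= N ->
  (forall l, 0 < l -> X <= l `^ (q - 1) / q * N + (1 - q^-1) / l * C) ->
  X <= C `^ (1 - q^-1) * N `^ q^-1.
Proof.
move=> q1 C0; have q0 : 0 < q by apply: lt_le_trans q1.
have qi : 0 < q^-1 by rewrite invr_gt0.
rewrite le_eqVlt => /predU1P[<-|N0] bnd.
  rewrite powR0 ?gt_eqF// mulr0 leNgt; apply/negP => X0.
  have := bnd (C / X); rewrite divr_gt0// mulr0 add0r => /(_ isT).
  have -> : (1 - q^-1) / (C / X) * C = X - q^-1 * X by field; rewrite !gt_eqF.
  have : 0 < q^-1 * X by rewrite mulr_gt0.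
  by lra.
have := bnd ((C / N) `^ q^-1); rewrite powR_gt0 ?divr_gt0// => /(_ isT).
move=> /le_trans; apply.
have CE : C = C `^ q^-1 * C `^ (1 - q^-1).
  by rewrite -powRD ?subrKC ?powRr1 ?(ltW C0)// oner_eq0.
have NE : N = N `^ q^-1 * N `^ (1 - q^-1).
  by rewrite -powRD ?subrKC ?powRr1 ?(ltW N0)// oner_eq0.
have divE p : (C / N) `^ p = C `^ p / N `^ p.
  rewrite powRM ?invr_ge0 ?(ltW C0) ?(ltW N0)//; congr (_ * _).
  by rewrite -powR_inv1 ?(ltW N0)// powRAC powR_inv1 ?powR_ge0.
have -> : ((C / N) `^ q^-1) `^ (q - 1) = C `^ (1 - q^-1) / N `^ (1 - q^-1).
  by rewrite -powRrM mulrBr mulVf ?gt_eqF// mulr1 divE.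
rewrite divE {2}NE [X in _ + _ * X <= _]CE.
have := powR_gt0 q^-1 C0; have := powR_gt0 q^-1 N0.
have := powR_gt0 (1 - q^-1) C0; have := powR_gt0 (1 - q^-1) N0.
move: (C `^ _) (N `^ _) (C `^ _) (N `^ _) => u v w z v0 u0 z0 w0.
by rewrite le_eqVlt; apply/orP; left; apply/eqP; field; rewrite !gt_eqF.
Qed.

End power_inequalities.

(** * Domination by the weight and its power mean inequality *)

Section weight.
Context {R : realType}.
Local Notation mu := (@lebesgue_measure R).
Variables (a b th : R).
Hypotheses (a0 : 0 < a) (ab : a < b) (th01 : 0 < th <= 1).

Let b0 : 0 < b. Proof. exact: lt_trans ab. Qed.
Let th0 : 0 < th. Proof. by case/andP: th01. Qed.

Let num (s : R) := s `^ th - (1 - s) `^ th + 2 * Num.max (1 - 2 * s) 0 `^ th.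

(** For [s >= 1/2] the modulus is the difference itself. For [s < 1/2] the claim amounts to
    [(1 - s)^th <= s^th + (1 - 2 s)^th], which is subadditivity. *)
Let normr_ker_le_num (s : R) : 0 <= s <= 1 -> `|s `^ th - (1 - s) `^ th| <= num s.
Proof.
move=> s01; have [s12|s12] := leP 2^-1 s.
  have le1 : (1 - s) `^ th <= s `^ th.
    by apply: ge0_ler_powR; rewrite ?nnegrE ?(ltW th0)//; lra.
  by rewrite ger0_norm ?subr_ge0// lerDl mulr_ge0 ?powR_ge0.
have le1 : s `^ th <= (1 - s) `^ th.
  by apply: ge0_ler_powR; rewrite ?nnegrE ?(ltW th0)//; lra.
rewrite ler0_norm ?subr_le0// /num max_l; last by lra.
have s0 : 0 <= s by lra.
have s2 : 0 <= 1 - 2 * s by lra.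
have := powR_subadditive th s (1 - 2 * s) th01 s0 s2.
have -> : s + (1 - 2 * s) = 1 - s by ring.
by lra.
Qed.

Lemma normr_ker_le_wbar (s : R) : 0 <= s <= 1 ->
  `|s `^ th - (1 - s) `^ th| / seg a b s ^+ 2 <= wbar a b th s.
Proof. by move=> s01; rewrite ler_wpM2r ?invr_ge0 ?sqr_ge0// normr_ker_le_num. Qed.

Lemma wbar_ge0 (s : R) : 0 <= s <= 1 -> 0 <= wbar a b th s.
Proof.
by move=> /normr_ker_le_wbar; apply: le_trans; rewrite divr_ge0 ?sqr_ge0.
Qed.

Lemma integrable_wbarM (k : R -> R) (M : R) : measurable_fun `[0 : R, 1] k ->
  (forall s : R, 0 <= s <= 1 -> `|k s| <= M) ->
  mu.-integrable `[0, 1] (EFin \o (fun s => wbar a b th s * k s)).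
Proof.
move=> mk kM.
rewrite (_ : (fun s => _) = (fun s => num s * k s / seg a b s ^+ 2)); last first.
  by apply/funext => s; rewrite /wbar -/(num s) mulrAC.
(* The 3 bounds [num]: at most 1 from [s^th] and at most 2 from the maximum. *)
apply: (integrable_segV2 _ _ a0 ab _ (3 * M)).
  apply: measurable_funM => //; apply: measurable_funD.
    apply: measurable_funB; apply: measurable_powR_comp => //; exact: measurable_onem.
  apply: measurable_funM => //; apply: measurable_powR_comp.
  apply: measurable_funTS; apply: measurable_maxr => //.
  by apply: measurable_funB => //; exact: measurable_funM.
move=> s s01; rewrite normrM; apply: ler_pM; rewrite ?kM//.
rewrite ger0_norm; last exact: le_trans (normr_ker_le_num _ s01).
have h1 : s `^ th <= 1 by apply: powR_le1 => //; exact: ltW.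
have h2 := powR_ge0 (1 - s) th.
have h3 : Num.max (1 - 2 * s) 0 `^ th <= 1.
  by apply: powR_le1; [exact: ltW|rewrite maxEle; case: ifPn; rewrite -?ltNge; lra].
by rewrite /num; lra.
Qed.

Let integrable_wbar : mu.-integrable `[0, 1] (EFin \o wbar a b th).
Proof.
rewrite (_ : wbar a b th = (fun s => wbar a b th s * 1)).
  by apply: (integrable_wbarM (cst 1) 1) => // s _; rewrite normr1.
by apply/funext => s; rewrite mulr1.
Qed.

(** Strict positivity is what the optimisation in [le_powR_young_optimal] asks of [C]. On [[3/4, 1]]
    the difference of powers stays at least its value at [3/4], and [seg <= b]. *)
Lemma C4_gt0 : 0 < C4 th a b.
Proof.
rewrite C4E//.
have h0 : (4^-1 : R) `^ th < (3 / 4) `^ th.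
  by apply: gt0_ltr_powR; rewrite ?nnegrE//; lra.
apply: (Rintegral_gt0 _ _ (3 / 4) 1 (((3 / 4) `^ th - 4^-1 `^ th) / b ^+ 2)) => //.
- by move=> x; rewrite /= in_itv /=; exact: wbar_ge0.
- by lra.
- by move=> x /=; rewrite !in_itv /=; lra.
- by rewrite divr_gt0 ?exprn_gt0// subr_gt0.
move=> x x34; have x01 : 0 <= x <= 1 by lra.
have sg := seg_gt0 _ _ a0 ab _ x01.
apply: ler_pM.
- by rewrite subr_ge0 ltW.
- by rewrite invr_ge0 sqr_ge0.
- apply: ler_wpDr; first by rewrite mulr_ge0 ?powR_ge0.
  by apply: lerB; apply: ge0_ler_powR; rewrite ?nnegrE ?(ltW th0)//; lra.
- rewrite lef_pV2 ?posrE ?exprn_gt0// lerXn2r ?nnegrE ?(ltW sg) ?(ltW b0)//.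
  exact: seg_le.
Qed.

Variable al : R.
Hypothesis al0 : 0 <= al.

Let integrable_powR_wbar :
  mu.-integrable `[0, 1] (EFin \o (fun s => s `^ al * wbar a b th s)).
Proof.
rewrite (_ : (fun s => _) = (fun s => wbar a b th s * s `^ al)).
  apply: (integrable_wbarM (fun s => s `^ al) 1) => //.
    exact: measurable_powR_comp.
  by move=> s s01; rewrite ger0_norm ?powR_ge0// powR_le1.
by apply/funext => s; rewrite mulrC.
Qed.

Lemma C5_ge0 : 0 <= C5 th al a b.
Proof.
rewrite C5E//; apply: Rintegral_ge0 => s; rewrite /= in_itv /= => s01.
by rewrite mulr_ge0 ?powR_ge0 ?wbar_ge0.
Qed.

Lemma C6_ge0 : 0 <= C6 th al a b.
Proof.
rewrite subr_ge0 C4E// C5E//; apply: le_Rintegral => // s; rewrite /= in_itv /= => s01.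
by rewrite ler_piMl ?wbar_ge0 ?powR_le1.
Qed.

Lemma Rintegral_wbar_affine (u v : R) :
  \int[mu]_(s in `[0, 1]) (wbar a b th s * (u * s `^ al + v)) =
  u * C5 th al a b + v * C4 th a b.
Proof.
have mI : measurable (`[0, 1]%classic : set (measurableTypeR R)) by exact: measurable_itv.
rewrite C4E// C5E// -!RintegralZl// -RintegralD//.
- by apply: eq_Rintegral => s _; ring.
- by have := integrableZl mI u integrable_powR_wbar.
- by have := integrableZl mI v integrable_wbar.
Qed.

(** For each [l], Young's inequality followed by the bound on [h^q] majorises [h] by an affine
    function of [s^al], whose integral against the weight is a combination of [C4] and [C5]; then
    [l] is optimised. *)
Lemma Rintegral_wbar_power_mean (h : R -> R) (q P Q M : R) : 1 <= q -> 0 <= P -> 0 <= Q ->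
  measurable_fun `[0 : R, 1] h ->
  (forall s : R, 0 <= s <= 1 -> 0 <= h s <= M) ->
  (forall s : R, 0 <= s <= 1 -> h s `^ q <= s `^ al * P + (1 - s `^ al) * Q) ->
  \int[mu]_(s in `[0, 1]) (wbar a b th s * h s) <=
  C4 th a b `^ (1 - q^-1) * (C5 th al a b * P + C6 th al a b * Q) `^ q^-1.
Proof.
move=> q1 P0 Q0 mh hM hq; have q0 : 0 < q by apply: lt_le_trans q1.
apply: le_powR_young_optimal => //.
- exact: C4_gt0.
- by rewrite addr_ge0// mulr_ge0 ?C5_ge0 ?C6_ge0.
move=> l l0; set A := _ / q; set B := _ / l.
have A0 : 0 <= A by rewrite divr_ge0 ?powR_ge0// ltW.
have -> : A * (C5 th al a b * P + C6 th al a b * Q) + B * C4 th a b =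
    \int[mu]_(s in `[0, 1]) (wbar a b th s * (A * (P - Q) * s `^ al + (A * Q + B))).
  by rewrite Rintegral_wbar_affine /C6; ring.
apply: le_Rintegral => //.
- apply: (integrable_wbarM _ M) => // s /hM /andP[h0 hM'].
  by rewrite ger0_norm.
- apply: (integrable_wbarM _ (`|A * (P - Q)| + `|A * Q + B|)).
    by apply: measurable_funD => //; apply: measurable_funM => //; exact: measurable_powR_comp.
  move=> s s01; rewrite (le_trans (ler_normD _ _))// lerD2r normrM ler_piMr//.
  by rewrite ger0_norm ?powR_ge0// powR_le1.
move=> s; rewrite /= in_itv /= => s01; rewrite ler_wpM2l ?wbar_ge0//.
have /andP[h0 _] := hM _ s01.
apply: le_trans (powR_young _ _ _ h0 l0 q1) _; rewrite -/A -/B.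
have := ler_wpM2l A0 (hq _ s01); lra.
Qed.

End weight.

(** * Bound on the derivative and assembly of the estimate *)

Theorem theorem6 (R : realType) (I : set R) (f : R -> R)
    (m alpha q th a b : R) :
  is_interval I -> (forall x, I x -> 0 < x) ->
  (forall x : R, interior I x -> derivable f x 1) ->
  0 < m <= 1 -> 0 <= alpha <= 1 -> 1 <= q -> 0 < th <= 1 ->
  a < b -> interior I a -> interior I (b / m) ->
  (@lebesgue_measure R).-integrable `[a, b] (EFin \o (derive1 f)) ->
  harm_convex alpha m (fun x => `|(derive1 f) x| `^ q) `[a, b / m] ->
  `|Ifrac f th a b|
    <= a * b * (b - a) / 2 * C4 th a b `^ (1 - q^-1)
       * (C5 th alpha a b * `|(derive1 f) a| `^ q
          + m * C6 th alpha a b * `|(derive1 f) (b / m)| `^ q) `^ (q^-1).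
Proof.
move=> itvI Ipos dI /andP[m0 m1] /andP[al0 al1] q1 th01 ab Ia Ibm intf' hc.
have a0 : 0 < a by apply: Ipos; exact: interior_subset.
have b0 : 0 < b := lt_trans a0 ab.
have bm : b <= b / m by rewrite ler_pdivlMr// ler_piMr// ltW.
(* As [m <= 1], [b <= b/m]. A point other than [a] and [b/m] has the neighbourhood []a, b/m[],
   contained in [I] because [I] is an interval. *)
have Iab x : a <= x <= b -> interior I x.
  move=> /andP[ax xb]; move: ax; rewrite le_eqVlt => /predU1P[<- //|ax].
  have := le_trans xb bm; rewrite le_eqVlt => /predU1P[-> //|xbm].
  have xin : x \in `]a, b / m[ by rewrite in_itv /= ax.
  rewrite /interior; near=> z.
  have : z \in `]a, b / m[ by near: z; exact: near_in_itvoo.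
  rewrite in_itv /= => /andP[az zb]; apply: (itvI a (b / m)).
  - exact: interior_subset.
  - exact: interior_subset.
  - by rewrite (ltW az) (ltW zb).
set f' := derive1 f.
have df (x : R) : a <= x <= b -> is_derive x 1 f (f' x).
  by move=> /Iab /dI d; apply: DeriveDef => //; rewrite /f' derive1E.
set P := `|f' a| `^ q; set Q := `|f' (b / m)| `^ q.
have P0 : 0 <= P := powR_ge0 _ _.
have mQ0 : 0 <= m * Q by rewrite mulr_ge0 ?powR_ge0// ltW.
have hq (s : R) : 0 <= s <= 1 ->
    `|f' (a * b / seg a b s)| `^ q <= s `^ alpha * P + (1 - s `^ alpha) * (m * Q).
  move=> s01; have /andP[ax xb] := seg_itv _ _ a0 ab _ s01.
  (* At the pair [(a, b/m)] the factors [m] cancel in the argument of the convexity inequality. *)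
  have E : m * a * (b / m) / (m * s * (b / m) + (1 - s) * a) = a * b / seg a b s.
    rewrite /seg; have sg := seg_gt0 _ _ a0 ab _ s01; rewrite /seg in sg.
    have -> : m * s * (b / m) = s * b by field; rewrite gt_eqF.
    by field; rewrite !gt_eqF.
  have := hc a (b / m) s; rewrite E /= !in_itv /= !lexx ax (le_trans xb bm).
  rewrite (le_trans (ltW ab) bm) => /(_ isT isT s01 isT) /le_trans; apply.
  by rewrite -/f' -/P -/Q; lra.
have f'M (x : R) : a <= x <= b -> `|f' x| <= 1 + (P + m * Q).
  move=> /andP[ax xb]; have x0 : 0 < x := lt_le_trans a0 ax.
  have ba0 : 0 < b - a by rewrite subr_gt0.
  (* The solution of [a b / B s = x], so that [hq] bounds [|f' x|^q] by [P + m Q]. Where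
     [|f' x| > 1], its [q]-th power is no smaller; the 1 in the bound covers the other case. *)
  pose s := (a * b / x - a) / (b - a).
  have s01 : 0 <= s <= 1.
    rewrite /s ler_pdivlMr// ler_pdivrMr// mul0r mul1r subr_ge0 lerD2r.
    rewrite ler_pdivlMr// ler_pdivrMr//; apply/andP; split.
      by rewrite ler_pM2l.
    by rewrite mulrC ler_pM2l.
  have xE : a * b / seg a b s = x.
    have -> : seg a b s = a * b / x by rewrite /seg /s; field; rewrite !gt_eqF.
    by field; rewrite !gt_eqF.
  have := hq s s01; rewrite xE => hx.
  have [le1|gt1] := leP `|f' x| 1.
    by rewrite (le_trans le1)// lerDl addr_ge0.
  apply: le_trans (le1r_powR (ltW gt1) q1) _; apply: le_trans hx _.
  have t0 := powR_ge0 s alpha; have t1 := powR_le1 s alpha al0 s01.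
  by nra.
have mf' : measurable_fun `[a, b] f'.
  by apply/measurable_EFinP; exact: measurable_int intf'.
rewrite (IfracE f f' a b th _ a0 ab th01 df f'M mf').
set K := a * b * (b - a) / 2.
have K0 : 0 <= K.
  by rewrite divr_ge0// mulr_ge0 ?subr_ge0 ?mulr_ge0// ltW.
rewrite normrM normrN (ger0_norm K0) -[leRHS]mulrA ler_wpM2l//.
rewrite -/P -/Q -[m * _ * Q]mulrA mulrCA.
have mh := measurable_f_seg f' a b a0 ab mf'.
have mnh : measurable_fun `[0 : R, 1] (fun s => `|f' (a * b / seg a b s)|).
  exact: measurableT_comp.
have hM (s : R) : 0 <= s <= 1 -> 0 <= `|f' (a * b / seg a b s)| <= 1 + (P + m * Q).
  by move=> s01; rewrite normr_ge0 f'M// seg_itv.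
have ih := integrable_wbarM a b th a0 ab th01 _ (1 + (P + m * Q)) mnh.
have {}ih : (@lebesgue_measure R).-integrable `[0, 1]
    (EFin \o (fun s => wbar a b th s * `|f' (a * b / seg a b s)|)).
  by apply: ih => s /hM /andP[_]; rewrite normr_id.
have ptw (s : R) : 0 <= s <= 1 ->
    `|(s `^ th - (1 - s) `^ th) * (f' (a * b / seg a b s) / seg a b s ^+ 2)| <=
    wbar a b th s * `|f' (a * b / seg a b s)|.
  move=> s01; rewrite !normrM normfV (ger0_norm (sqr_ge0 _)).
  by rewrite [X in _ * X <= _]mulrC mulrA ler_wpM2r// normr_ker_le_wbar.
have ik : (@lebesgue_measure R).-integrable `[0, 1] (EFin \o (fun s =>
    (s `^ th - (1 - s) `^ th) * (f' (a * b / seg a b s) / seg a b s ^+ 2))).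
  apply: le_integrable ih => //.
    apply/measurable_EFinP; apply: measurable_funM.
      apply: measurable_funB; apply: measurable_powR_comp => //; exact: measurable_onem.
    by apply: measurable_funM => //; exact: measurable_segV2.
  move=> s; rewrite /= in_itv /= => s01; rewrite lee_fin.
  exact: le_trans (ptw _ s01) (ler_norm _).
apply: le_trans (le_normr_Rintegral _ ik) _ => //.
apply: le_trans (Rintegral_wbar_power_mean a b th a0 ab th01 alpha al0 _ q P (m * Q) _ q1 P0 mQ0 mnh hM hq).
apply: le_Rintegral => //.
  exact: integrable_norm ik.
Unshelve. all: by end_near. Qed.
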